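(* Let $K$ be a field, let $w$ be a standard linear weighting of $S=K[t_1,\ldots,t_s]$, let $I$ be a monomial ideal of $S$, and let $I_w$ be its weighted monomial ideal. The following hold. (a) If $I$ has no embedded primes, then, for $n\geq 1$, $I$ is a Simis ideal in degree $n$ if and only if $I_w$ is a Simis ideal in degree $n$. (b) $I$ is a Simis ideal if and only if $I_w$ is a Simis ideal. (c) $\mathrm{Ass}(I^n)=\mathrm{Ass}((I_w)^n)$ for all $n\geq 1$. (d) $I$ is normally torsion-free if and only if $I_w$ is normally torsion-free. (e) $I$ is Cohen–Macaulay if and only if $I_w$ is Cohen–Macaulay. (f) $I$ is unmixed if and only if $I_w$ is unmixed.
   Context: For $a\in\mathbb{N}^s$ write $t^a=t_1^{a_1}\cdots t_s^{a_s}$. A standard linear weighting of $S$ is a linear map $w\colon\mathbb{R}^s\to\mathbb{R}^s$ of the form $w(a)=(d_1a_1,\ldots,d_sa_s)$ for some positive integers $d_1,\ldots,d_s$. The weighted monomial ideal of $I$ is $I_w:=(\{t^{w(a)}\mid t^a\in I\})$. $\mathrm{Ass}(I)$ is the set of associated primes of $I$, i.e. prime ideals of the form $(I\colon f)$ with $f\in S$; an embedded prime of $I$ is an associated prime of $I$ properly containing another associated prime of $I$; $\mathrm{minAss}(I)$ is the set of inclusion-minimal elements of $\mathrm{Ass}(I)$. For $n\geq 1$, the $n$-th symbolic power of $I$ is $I^{(n)}:=\bigcap_{\mathfrak{p}\in\mathrm{minAss}(I)}(I^nS_{\mathfrak{p}}\cap S)$. A monomial ideal $I$ is Simis in degree $n$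 if $I^{(n)}=I^n$, and is a Simis ideal if $I^{(n)}=I^n$ for all $n\geq 1$. A monomial ideal $I$ is normally torsion-free if $\mathrm{Ass}(I^n)\subset\mathrm{Ass}(I)$ for all $n\geq 1$. As usual, $I$ is Cohen–Macaulay if the quotient ring $S/I$ is Cohen–Macaulay, and $I$ is unmixed if all its associated primes have the same height. *)

(* Defs.v *)
From HB Require Import structures.
From mathcomp Require Import all_boot all_order all_algebra.
From mathcomp Require Import ring_quotient.
From mathcomp Require Import boolp classical_sets.
From mathcomp Require Import mpoly.

Set Implicit Arguments.
Unset Strict Implicit.
Unset Printing Implicit Defensive.

Import GRing.Theory.

Local Open Scope classical_set_scope.
Local Open Scope ring_scope.

(* Ideals are sets I : set R, since the library's idealr excludes the unit   *)
(* ideal, which is a monomial ideal.  Primes use the library's prime_idealr: *)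
(* these are boolean predicates, but classically every prime ideal is one.   *)

Section Ideals.
Variable R : comNzRingType.
Implicit Types (I J : set R) (p q : prime_idealr R).

Definition pset p : set R := [set x | x \in (p : pred R)].

Definition ideal_gen (G : set R) : set R :=
  [set x | exists n (a g : 'I_n -> R),
     (forall i, G (g i)) /\ x = \sum_(i < n) a i * g i].

Definition ideal_exp I n : set R :=
  ideal_gen [set \prod_(i < n) f i | f in [set f : 'I_n -> R | forall i, I (f i)]].

Definition colon I (f : R) : set R := [set g | I (g * f)].

Definition Ass I : set (prime_idealr R) :=
  [set p | exists f, pset p = colon I f].

Definition minAss I : set (prime_idealr R) :=
  [set p | Ass I p /\ forall q, Ass I q -> ~ pset q `<` pset p].

Definition embedded_primes I : set (prime_idealr R) :=
  [set p | Ass I p /\ exists2 q, Ass I q & pset q `<` pset p].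

Definition normally_torsion_free I : Prop :=
  forall n, (1 <= n)%N -> Ass (ideal_exp I n) `<=` Ass I.

Definition is_max (E : set nat) (d : nat) : Prop :=
  E d /\ forall m, E m -> (m <= d)%N.

(* c 0 < c 1 < ... < c d; the values c i for i > d are irrelevant. *)
Definition prime_chain (c : nat -> prime_idealr R) (d : nat) : Prop :=
  forall i, (i < d)%N -> pset (c i) `<` pset (c i.+1).

Definition height p (h : nat) : Prop :=
  is_max [set d | exists2 c, prime_chain c d & pset (c d) = pset p] h.

Definition unmixed I : Prop := exists h, forall p, Ass I p -> height p h.

(* Primes of R/J are the primes of R containing J. *)
Definition quo_krull_dim J (d : nat) : Prop :=
  is_max [set k | exists2 c, prime_chain c k & J `<=` pset (c 0%N)] d.

(* J + (x_1, ..., x_k) *)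
Definition ideal_adjoin J (xs : seq R) : set R :=
  ideal_gen (J `|` [set x | x \in xs]).

(* xs is a regular sequence on the R-module R/J. *)
Definition quo_regular J (xs : seq R) : Prop :=
  (forall i, (i < size xs)%N -> forall y,
     ideal_adjoin J (take i xs) (xs`_i * y) -> ideal_adjoin J (take i xs) y)
  /\ ~ ideal_adjoin J xs 1.

Definition quo_depth (m J : set R) (d : nat) : Prop :=
  is_max [set k | exists xs : seq R,
    [/\ size xs = k, forall x, x \in xs -> m x & quo_regular J xs]] d.

(* For R local with maximal ideal m and J contained in m: the local ring R/J *)
(* satisfies depth (R/J) = dim (R/J).                                        *)
Definition quo_local_CM (m J : set R) : Prop :=
  exists2 d, quo_krull_dim J d & quo_depth m J d.

End Ideals.

(* The localization of a domain R at a prime p, inside the fraction field. *)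

Section Localization.
Variables (R : idomainType) (p : prime_idealr R).

Definition loc_pred : pred {fraction R} := fun x =>
  `[< exists a s : R, s \notin (p : pred R) /\ x = tofrac a / tofrac s >].

Lemma loc_den_neq0 (s : R) : s \notin (p : pred R) -> tofrac s != 0.
Proof.
by move=> sp; rewrite tofrac_eq0; apply: contraNneq sp => ->; rewrite idealr0.
Qed.

Lemma loc_predP (a s : R) :
  s \notin (p : pred R) -> loc_pred (tofrac a / tofrac s).
Proof. by move=> sp; apply/asboolP; exists a, s. Qed.

Fact loc_subring_closed : subring_closed loc_pred.
Proof.
have p1 : (1 : R) \notin (p : pred R) by rewrite idealr1.
split=> [|x y|x y].
- by rewrite -[1]divr1 -tofrac1; apply: loc_predP.
- move=> /asboolP[a [s [sp ->]]] /asboolP[b [t [tp ->]]].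
  rewrite -mulNr addf_div ?loc_den_neq0// -tofracN -!tofracM -tofracD.
  by apply: loc_predP; rewrite prime_idealrM negb_or sp.
- move=> /asboolP[a [s [sp ->]]] /asboolP[b [t [tp ->]]].
  rewrite mulf_div -!tofracM.
  by apply: loc_predP; rewrite prime_idealrM negb_or sp.
Qed.

HB.instance Definition _ :=
  GRing.isSubringClosed.Build {fraction R} loc_pred loc_subring_closed.

Record localization := Localize {
  loc_val :> {fraction R};
  _ : loc_val \in loc_pred }.

HB.instance Definition _ := [isSub for loc_val].
HB.instance Definition _ := [Choice of localization by <:].
HB.instance Definition _ :=
  [SubChoice_isSubComNzRing of localization by <:].

Fact to_loc_subproof (a : R) : tofrac a \in loc_pred.
Proof.
by rewrite -[tofrac a]divr1 -tofrac1; apply: loc_predP; rewrite idealr1.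
Qed.

Definition to_loc (a : R) : localization := Localize (to_loc_subproof a).

Definition ideal_loc (I : set R) : set localization := ideal_gen (to_loc @` I).

End Localization.

Arguments to_loc {R} p a.
Arguments ideal_loc {R} p I _.

Section DomainIdeals.
Variable R : idomainType.
Implicit Type I : set R.

Definition symbolic_power I n : set R :=
  \bigcap_(p in minAss I) (to_loc p @^-1` ideal_loc p (ideal_exp I n)).

Definition Simis_in_degree n I : Prop := symbolic_power I n = ideal_exp I n.

Definition Simis I : Prop := forall n, (1 <= n)%N -> Simis_in_degree n I.

(* R/I is Cohen-Macaulay: its localizations at primes are the local rings    *)
(* R_p / I R_p, for p a prime of R containing I.                             *)
Definition Cohen_Macaulay_ideal I : Prop :=
  forall p : prime_idealr R, I `<=` pset p ->
    quo_local_CM (ideal_loc p (pset p)) (ideal_loc p I).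

End DomainIdeals.

Section MonomialIdeals.
Variables (K : fieldType) (s : nat).
Implicit Type I : set {mpoly K[s]}.

Definition monomial_ideal I : Prop :=
  exists M : set 'X_{1..s}, I = ideal_gen [set 'X_[a] | a in M].

(* Only the action of the linear map on exponent vectors is recorded. *)
Definition standard_linear_weighting (w : 'X_{1..s} -> 'X_{1..s}) : Prop :=
  exists2 d : 'I_s -> nat, (forall i, (0 < d i)%N) &
    forall (a : 'X_{1..s}) (i : 'I_s), w a i = (d i * a i)%N.

Definition weighted_ideal (w : 'X_{1..s} -> 'X_{1..s}) I : set {mpoly K[s]} :=
  ideal_gen [set 'X_[w a] | a in [set a | I 'X_[a]]].

End MonomialIdeals.

(* Main.v *)
From HB Require Import structures.
Require Import Defs.
From mathcomp Require Import all_boot all_order all_algebra.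
From mathcomp Require Import ring_quotient.
From mathcomp Require Import boolp classical_sets.
From mathcomp Require Import mpoly.
From Stdlib Require Import Ring.

(** Let [phi] be the endomorphism [t_i |-> t_i^(d_i)] of [S = K[t_1, ..., t_s]].
    It sends [t^a] to [t^(w a)], so that [I_w] is the extension of [I] along
    [phi].  The monomials [t^r] with [0 <= r_i < d_i] form a basis of [S] over
    [phi S]; hence an element lies in the extension of an ideal [J] exactly when
    all its coordinates lie in [J] ([extP]).  Moreover [S] is integral over
    [phi S].  Every part of the theorem compares [I] and [I_w] along this
    integral free extension.

    Associated primes and powers.  Extension commutes with powers
    ([ext_exp]), and powers of monomial ideals are monomial, so it suffices to
    compare [Ass J] with [Ass J_w] for one monomial ideal [J].  An associated
    prime of a monomial ideal has the form [(J : t^a)] and is monomial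
    ([assoc_prime_colon_monomial]); membership in such a prime depends only on
    the support of an exponent, which [w] preserves.  Taking [b] to be the
    largest exponent whose quotient by [d] is [a], the ideals [(J : t^a)] and
    [(J_w : t^b)] agree, and conversely [(J_w : t^b)] is [(J : t^a)] for [a] the
    quotient of [b] ([Ass_ext]).  This gives the statements on [Ass], on normal
    torsion-freeness and on unmixedness.

    Symbolic powers.  [I] and [I_w] have the same minimal primes, and these are
    monomial.  For a monomial ideal and a monomial prime [P], localizing at [P]
    only inverts monomials outside [P] ([sat_monomial]); these can be raised to
    images under [phi], so [f] lies in the localized extension of [J = I^n]
    precisely when its coordinates lie in the localization of [J].  Hence
    equality of ordinary and symbolic powers passes both ways
    ([Simis_in_degree_ext]), degree by degree.

    Cohen-Macaulayness.  Let [q] be a prime of [S] and [p = phi^-1 q].  The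
    local rings of [S/I] at [p] and of [S/I_w] at [q] have the same dimension,
    by going down for the flat map [phi] and incomparability for integral
    extensions ([chain_between_ext]), and they admit regular sequences of the
    same lengths.  Regular sequences extend by flatness ([lreg_ext]).  For the
    descent ([lreg_descent]), the fibre over [p] is zero-dimensional, so a
    nonzerodivisor in [q] forces one in [p]; after dividing by it one needs that
    the quotient upstairs still has a regular sequence with only one element
    fewer, which is Rees's exchange argument ([regular_exchange]).  Primes over
    every [p] exist, so the Cohen-Macaulay condition at all primes is the same
    for [I] and [I_w] ([Cohen_Macaulay_ext]).  Exchange and descent rest on
    prime avoidance in the Noetherian ring [S] ([common_nzd],
    [noetherian_mpoly]). *)

Set Implicit Arguments.
Unset Strict Implicit.
Unset Printing Implicit Defensive.

Import GRing.Theory.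

Local Open Scope classical_set_scope.
Local Open Scope ring_scope.

(** * Ideals and primes as sets *)

(** The ring operations, each under a single head symbol: the [ring] decision
    procedure compares operations syntactically, whereas the same sum or product
    can be reached through several paths of structure inheritance. *)
Definition ring_zero (R : comNzRingType) : R := 0.
Definition ring_one (R : comNzRingType) : R := 1.
Definition ring_add (R : comNzRingType) (x y : R) : R := x + y.
Definition ring_mul (R : comNzRingType) (x y : R) : R := x * y.
Definition ring_opp (R : comNzRingType) (x : R) : R := - x.

Lemma comNzRing_theory (R : comNzRingType) :
  @ring_theory R (@ring_zero R) (@ring_one R) (@ring_add R) (@ring_mul R)
    (fun x y => ring_add x (ring_opp y)) (@ring_opp R) eq.
Proof.
split=> //; rewrite /ring_add /ring_mul /ring_opp /ring_zero /ring_one.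
- exact: add0r.
- exact: addrC.
- exact: addrA.
- exact: mul1r.
- exact: mulrC.
- exact: mulrA.
- exact: mulrDl.
- exact: subrr.
Qed.

Ltac comring :=
  match goal with |- @eq _ ?a ?b => change (@eq (GRing.ComNzRing.sort _) a b) end;
  match goal with |- @eq (GRing.ComNzRing.sort ?R) _ _ =>
    repeat match goal with
    | |- context [@Algebra.add ?i ?a ?b] =>
        change (@Algebra.add i a b) with (@ring_add R a b)
    | |- context [@GRing.mul ?i ?a ?b] =>
        change (@GRing.mul i a b) with (@ring_mul R a b)
    | |- context [@Algebra.opp ?i ?a] =>
        change (@Algebra.opp i a) with (@ring_opp R a)
    | |- context [@Algebra.zero ?i] =>
        change (@Algebra.zero i) with (@ring_zero R)
    | |- context [@GRing.one ?i] => change (@GRing.one i) with (@ring_one R)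
    end
  end; ring.

Section IdealSets.
Variable R : comNzRingType.
Implicit Types (I J P : set R) (x y z u : R).

Definition is_ideal J : Prop :=
  [/\ J 0, forall x y, J x -> J y -> J (x + y) & forall a x, J x -> J (a * x)].

Definition is_prime P : Prop :=
  [/\ is_ideal P, ~ P 1 & forall x y, P (x * y) -> P x \/ P y].

Lemma ideal0 J : is_ideal J -> J 0. Proof. by case. Qed.

Lemma idealD J x y : is_ideal J -> J x -> J y -> J (x + y).
Proof. by case=> _ + _; apply. Qed.

Lemma idealMl J a x : is_ideal J -> J x -> J (a * x).
Proof. by case=> _ _; apply. Qed.

Lemma idealMr J x a : is_ideal J -> J x -> J (x * a).
Proof. by move=> iJ Jx; rewrite mulrC; apply: idealMl. Qed.

Lemma idealN J x : is_ideal J -> J x -> J (- x).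
Proof. by move=> iJ Jx; rewrite -mulN1r; apply: idealMl. Qed.

Lemma idealB J x y : is_ideal J -> J x -> J y -> J (x - y).
Proof. by move=> iJ Jx Jy; apply: idealD => //; apply: idealN. Qed.

Lemma ideal_sum J (T : Type) (r : seq T) (Q : pred T) (F : T -> R) :
  is_ideal J -> (forall i, Q i -> J (F i)) -> J (\sum_(i <- r | Q i) F i).
Proof.
move=> iJ JF; elim/big_ind: _ => //; first exact: ideal0.
by move=> x y; apply: idealD.
Qed.

Lemma ideal_gen_ideal (G : set R) : is_ideal (ideal_gen G).
Proof.
split.
- by exists 0%N, (fun=> 0), (fun=> 0); split; [case|rewrite big_ord0].
- move=> _ _ [n [a [g [Gg ->]]]] [m [b [h [Gh ->]]]].
  pose f T (u : 'I_n -> T) (v : 'I_m -> T) i :=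
    match split i with inl j => u j | inr j => v j end.
  exists (n + m)%N, (f R a b), (f R g h); split=> [i|].
    by rewrite /f; case: (split i).
  by rewrite big_split_ord /f; congr (_ + _); apply: eq_bigr => i _;
    rewrite ?(unsplitK (inl i)) ?(unsplitK (inr i)).
- move=> c _ [n [a [g [Gg ->]]]]; exists n, (fun i => c * a i), g; split=> //.
  by rewrite mulr_sumr; apply: eq_bigr => i _; rewrite mulrA.
Qed.

Lemma ideal_gen_sub (G : set R) : G `<=` ideal_gen G.
Proof.
move=> x Gx; exists 1%N, (fun=> 1), (fun=> x); split=> //.
by rewrite big_ord1 mul1r.
Qed.

Lemma ideal_gen_min (G J : set R) :
  is_ideal J -> G `<=` J -> ideal_gen G `<=` J.
Proof.
move=> iJ GJ _ [n [a [g [Gg ->]]]]; apply: ideal_sum => // i _.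
by apply: idealMl => //; apply: GJ.
Qed.

Lemma colon_ideal J u : is_ideal J -> is_ideal (colon J u).
Proof.
move=> iJ; split; rewrite /colon /=.
- by rewrite mul0r; apply: ideal0.
- by move=> x y Jx Jy; rewrite mulrDl; apply: idealD.
- by move=> a x Jx; rewrite -mulrA; apply: idealMl.
Qed.

Lemma prime_ideal P : is_prime P -> is_ideal P. Proof. by case. Qed.

Lemma primeM P x y : is_prime P -> P (x * y) -> P x \/ P y.
Proof. by case=> _ _; apply. Qed.

Lemma notin_primeM P x y : is_prime P -> ~ P x -> ~ P y -> ~ P (x * y).
Proof. by move=> pP Px Py /(primeM pP)[]. Qed.

Lemma notin_prime1 P : is_prime P -> ~ P 1. Proof. by case. Qed.

Lemma prime_prod P (T : eqType) (r : seq T) (F : T -> R) :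
  is_prime P -> P (\prod_(i <- r) F i) -> exists2 i, i \in r & P (F i).
Proof.
move=> pP; elim: r => [|i r IHr]; first by rewrite big_nil => /notin_prime1.
rewrite big_cons => /(primeM pP)[Pi|/IHr[j rj Pj]].
  by exists i; rewrite ?mem_head.
by exists j; rewrite // in_cons rj orbT.
Qed.

Lemma prime_exp P x n : is_prime P -> P (x ^+ n) -> P x.
Proof.
move=> pP; elim: n => [|n IHn]; first by rewrite expr0 => /notin_prime1.
by rewrite exprS => /(primeM pP)[].
Qed.

Lemma psetP (p : prime_idealr R) : is_prime (pset p).
Proof.
split; rewrite /pset /=.
- split=> [|x y|a x] /=; first by rewrite idealr0.
    by move=> px py; rewrite rpredD.
  by rewrite prime_idealrM orbC => ->.
- by rewrite idealr1.
- by move=> x y; rewrite prime_idealrM => /orP.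
Qed.

(** Classically every prime ideal is decidable, so quantifying over
    [prime_idealr] loses no prime. *)
Lemma prime_idealr_of P : is_prime P -> exists p : prime_idealr R, pset p = P.
Proof.
case=> iP nP1 Pprime; pose S : pred R := fun x => `[< P x >].
have Sideal : idealr_closed S.
  split=> [||a x y]; first by apply/asboolP; apply: ideal0.
    by apply/negP => /asboolP.
  move=> /asboolP Px /asboolP Py; apply/asboolP.
  by apply: idealD => //; apply: idealMl.
have Sprime : prime_idealr_closed S.
  move=> x y /asboolP /Pprime[Px|Py]; apply/orP; [left|right]; exact/asboolP.
pose b1 := GRing.isZmodClosed.Build R S (idealr_closedB Sideal).
pose b2 := isProperIdeal.Build R S (idealr_closed_nontrivial Sideal).
pose b3 := isPrimeIdealrClosed.Build R S Sprime.
pose T1 := HB.pack_for (idealr R) S b1 b2.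
pose p : prime_idealr R := HB.pack_for (prime_idealr R) S T1 b3.
exists p; apply/seteqP; split=> x; rewrite /pset /=; first by move/asboolP.
by move=> Px; apply/asboolP.
Qed.

End IdealSets.

(** * Noetherian rings and prime avoidance *)

Section Noetherian.
Variable R : comNzRingType.
Add Ring R_ring_noetherian : (comNzRing_theory R).
Implicit Types (I J P Q p : set R) (x y z u v : R).

(** The maximality form of the Noetherian condition: it gives maximal elements
    without dependent choice and passes directly to quotients. *)
Definition noetherian : Prop :=
  forall C : set (set R), (exists J, C J) -> C `<=` is_ideal (R := R) ->
  exists2 M, C M & forall J, C J -> M `<=` J -> J `<=` M.

(** The ideal [J + (x)]. *)
Definition adjoin1 J x : set R := [set f | exists a, J (f - a * x)].

(** [x] is a nonzerodivisor on [R/J]. *)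
Definition nzd J x : Prop := forall u, J (x * u) -> J u.

Definition assoc_prime J P : Prop := is_prime P /\ exists u, P = colon J u.

Lemma adjoin1_ideal J x : is_ideal J -> is_ideal (adjoin1 J x).
Proof.
move=> iJ; split=> [|f g [a Ja] [b Jb]|c f [a Ja]].
- by exists 0; rewrite mul0r subr0; apply: ideal0.
- exists (a + b); rewrite (_ : _ - _ = f - a * x + (g - b * x)); last by comring.
  exact: idealD.
- exists (c * a); rewrite (_ : _ - _ = c * (f - a * x)); last by comring.
  exact: idealMl.
Qed.

Lemma adjoin1_sub J x : is_ideal J -> J `<=` adjoin1 J x.
Proof. by move=> iJ f Jf; exists 0; rewrite mul0r subr0. Qed.

Lemma adjoin1_mem J x : is_ideal J -> adjoin1 J x x.
Proof. by move=> iJ; exists 1; rewrite mul1r subrr; apply: ideal0. Qed.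

Lemma adjoin1C J x y : is_ideal J -> adjoin1 (adjoin1 J x) y = adjoin1 (adjoin1 J y) x.
Proof.
move=> iJ; apply/seteqP; split=> f [a [b Jab]]; exists b, a;
  by rewrite -addrA [- _ - _]addrC addrA.
Qed.

(** An ideal maximal among those containing [J] and disjoint from the
    multiplicative set [T] is prime: if [x] and [y] are outside it, then adding
    either of them meets [T], and the product of the two meeting points shows
    that [x * y] is outside as well. *)
Lemma exists_prime_disjoint (T J : set R) : noetherian -> is_ideal J ->
    T 1 -> (forall x y, T x -> T y -> T (x * y)) ->
    (forall x, T x -> ~ J x) ->
  exists Q, [/\ is_prime Q, J `<=` Q & forall x, T x -> ~ Q x].
Proof.
move=> nR iJ T1 TM TJ.
pose C I := [/\ is_ideal I, J `<=` I & forall x, T x -> ~ I x].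
have [||M [iM JM TdM] maxM] := nR C; [by exists J; split | by move=> I [] |].
exists M; split=> //; split=> // [|x y Mxy]; first exact: TdM.
have meets z : ~ M z -> exists2 t, T t & adjoin1 M z t.
  move=> Mz; apply: contrapT => noT; apply: Mz; apply: (maxM (adjoin1 M z)).
  - split; first exact: adjoin1_ideal.
      by apply: subset_trans JM _; apply: adjoin1_sub.
    by move=> t Tt Mt; apply: noT; exists t.
  - exact: adjoin1_sub.
  - exact: adjoin1_mem.
apply: contrapT => /not_orP[/meets[s Ts [a Ma]] /meets[t Tt [b Mb]]].
apply: (TdM (s * t)); first exact: TM.
rewrite (_ : s * t = t * (s - a * x) + a * x * (t - b * y) + a * b * (x * y));
  last by comring.
by apply: idealD => //; [apply: idealD => //|]; apply: idealMl.
Qed.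

(** A maximal element among the colons [(J : v)] that contain [z] is prime. *)
Lemma zero_divisor_assoc_prime J z u : noetherian -> is_ideal J ->
  J (z * u) -> ~ J u -> exists P, assoc_prime J P /\ P z.
Proof.
move=> nR iJ Jzu Ju.
pose C I := exists v, [/\ I = colon J v, J (z * v) & ~ J v].
have [|I [v [-> _ _]]|_ [v [-> Jzv Jv]] maxv] := nR C.
- by exists (colon J u), u.
- exact: colon_ideal.
exists (colon J v); split=> //; split; last by exists v.
split; [exact: colon_ideal | by rewrite /colon /= mul1r|].
move=> x y Jxy; apply: contrapT => /not_orP[Jx Jy]; apply: Jx.
apply: (maxv (colon J (y * v))).
- exists (y * v); split=> //.
  by rewrite mulrCA; apply: idealMl.
- by move=> w Jw; rewrite /colon /= mulrCA; apply: idealMl.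
- by rewrite /colon /= mulrA.
Qed.

(** Noetherian induction on [J]: if [P = (J : u)] is associated to [J], an
    associated prime [(J : v)] other than [P] is associated to [J + (u)], since
    a multiple of [v] in [J + (u)] outside [J] would be a multiple of [u]
    modulo [J], and all of those outside [J] have annihilator [P]. *)
Lemma finite_assoc_primes J : noetherian -> is_ideal J ->
  exists n (f : nat -> set R),
    forall Q, assoc_prime J Q -> exists2 i, (i < n)%N & Q = f i.
Proof.
move=> nR iJ; apply: contrapT => noJ.
pose C I := is_ideal I /\ ~ exists n (f : nat -> set R),
    forall Q, assoc_prime I Q -> exists2 i, (i < n)%N & Q = f i.
have [||M [iM infM] maxM] := nR C; [by exists J; split | by move=> I [] |].
have [[P [pP [u Pu]]]|noM] := pselect (exists P, assoc_prime M P); last first.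
  apply: infM; exists 0%N, (fun=> set0) => Q MQ.
  by case: noM; exists Q.
have Mu : ~ M u by move=> Mu; apply: (notin_prime1 pP); rewrite Pu /colon /= mul1r.
have [n [f fP]] : exists n (f : nat -> set R), forall Q,
    assoc_prime (adjoin1 M u) Q -> exists2 i, (i < n)%N & Q = f i.
  apply: contrapT => inf; apply: Mu; apply: (maxM (adjoin1 M u)).
  - by split=> //; apply: adjoin1_ideal.
  - exact: adjoin1_sub.
  - exact: adjoin1_mem.
apply: infM; exists n.+1, (fun i => if i is i'.+1 then f i' else P).
move=> Q [pQ [v Qv]].
have [[a [[b Mb] Mav]]|noa] := pselect (exists a, adjoin1 M u (a * v) /\ ~ M (a * v)).
  (* Here a * v is congruent to b * u modulo M and is not in M, so both colons
     are the annihilator of this common element. *)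
  exists 0%N => //; rewrite Qv Pu; apply/seteqP; split=> c; rewrite /colon /= => Mc.
    have : P (c * b).
      rewrite Pu /colon /= (_ : c * b * u = a * (c * v) - c * (a * v - b * u));
        last by comring.
      by apply: idealB => //; apply: idealMl.
    case/(primeM pP) => [|Pb]; first by rewrite Pu.
    case: Mav; rewrite (_ : a * v = a * v - b * u + b * u); last by comring.
    by apply: idealD => //; move: Pb; rewrite Pu.
  have : Q (a * c).
    rewrite Qv /colon /= (_ : a * c * v = c * (a * v - b * u) + b * (c * u));
      last by comring.
    by apply: idealD => //; apply: idealMl.
  case/(primeM pQ); last by rewrite Qv.
  by rewrite Qv /colon /= => /Mav.
have [|i ltin Qi] := fP Q; last by exists i.+1.
split=> //; exists v; apply/seteqP; split=> c; rewrite Qv /colon /= => Mc.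
  exact: adjoin1_sub.
by apply: contrapT => nMc; apply: noa; exists c.
Qed.

(** Induction on a set of primes not containing [p].  If for each [i] an element
    [z i] of [p] avoids all the primes but the [i]-th, then so does
    [z i0 + b * w] for all of them, where [w] is the product of the other [z j]
    and [b] is an element of [p] outside the prime [f i0]. *)
Lemma prime_avoidance p n (f : nat -> set R) : is_ideal p ->
  exists2 z, p z &
    forall i, (i < n)%N -> is_prime (f i) -> ~ p `<=` f i -> ~ f i z.
Proof.
move=> ip; pose good i := is_prime (f i) /\ ~ p `<=` f i.
suff main k (A : {set 'I_n}) : #|A| = k -> (forall i, i \in A -> good i) ->
    exists2 z, p z & forall i, i \in A -> ~ f i z.
  pose A := [set i : 'I_n | `[< good i >]]%SET.
  have [i|z pz zA] := main _ A erefl; first by rewrite inE => /asboolP.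
  exists z => // i ltin pi npi; apply: (zA (Ordinal ltin)).
  by rewrite inE; apply/asboolP.
elim: k A => [|k IHk] A cardA goodA.
  by exists 0 => [|i]; [apply: ideal0 | rewrite (cards0_eq cardA) inE].
apply: contrapT => noz.
have {noz} zA z : p z -> exists2 i, i \in A & f i z.
  move=> pz; apply: contrapT => noi; apply: noz; exists z => // i Ai fiz.
  by apply: noi; exists i.
have /choice[z zP] : forall i, exists z, i \in A ->
    [/\ p z, f i z & forall j, j \in A -> j != i -> ~ f j z].
  move=> i; have [Ai|_] := boolP (i \in A); last by exists 0.
  have [||z pz zi] := IHk (A :\ i)%SET.
  - by move: cardA; rewrite (cardsD1 i) Ai => -[].
  - by move=> j; rewrite !inE => /andP[_ /goodA].
  have {}zi j : j \in A -> j != i -> ~ f j z.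
    by move=> Aj ji; apply: zi; rewrite !inE ji.
  exists z => _; split=> //; have [j Aj fjz] := zA z pz.
  by have [<-|/(zi _ Aj)] := eqVneq j i.
have /card_gt0P[i0 Ai0] : (0 < #|A|)%N by rewrite cardA.
have [pi0 /existsNP[b /not_implyP[pb fb]]] := goodA _ Ai0.
pose w := \prod_(j <- enum (A :\ i0)%SET) z j.
have [pz0 fz0 zi0] := zP _ Ai0.
have [|i Ai fi] := zA (z i0 + b * w).
  by apply: idealD => //; apply: idealMr.
have [pfi _] := goodA _ Ai; have ifi := prime_ideal pfi.
have [ii0|ii0] := eqVneq i i0.
  move: fi pfi ifi; rewrite ii0 => fi pfi ifi.
  have : f i0 (b * w) by rewrite -(addKr (z i0) (b * w)) addrC; apply: idealB.
  case/(primeM pfi) => // /(prime_prod pfi)[j].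
  rewrite mem_enum !inE => /andP[ji0 Aj]; have [_ _] := zP _ Aj.
  by apply => //; rewrite eq_sym.
apply: (zi0 i) => //.
rewrite -(addrK (b * w) (z i0)); apply: idealB => //; apply: idealMl => //.
rewrite /w (big_rem i) ?mem_enum ?inE ?ii0 //=; apply: idealMr => //.
by have [] := zP _ Ai.
Qed.

(** If [p] annihilates no nonzero element of any of the [R/J_k], then [p] is
    contained in none of their finitely many associated primes, and prime
    avoidance applies. *)
Lemma common_nzd p n (J : nat -> set R) : noetherian -> is_ideal p ->
    (forall k, (k < n)%N -> is_ideal (J k)) ->
    (forall k, (k < n)%N -> forall u, (forall y, p y -> J k (y * u)) -> J k u) ->
  exists2 z, p z & forall k, (k < n)%N -> nzd (J k) z.
Proof.
move=> nR ip iJ depthJ.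
have [m [f fP]] : exists m (f : nat -> set R), forall k, (k < n)%N ->
    forall Q, assoc_prime (J k) Q -> exists2 i, (i < m)%N & Q = f i.
  elim: n iJ {depthJ} => [|n IHn] iJ; first by exists 0%N, (fun=> set0).
  have [k ltkn|m [f fP]] := IHn; first by apply: iJ; apply: ltnW.
  have [m' [f' f'P]] := finite_assoc_primes nR (iJ n (ltnSn n)).
  exists (m + m')%N, (fun i => if (i < m)%N then f i else f' (i - m)%N).
  move=> k; rewrite ltnS leq_eqVlt => /orP[/eqP -> Q /f'P[i lti ->]|].
    by exists (m + i)%N; rewrite ?ltn_add2l // ltnNge leq_addr /= addKn.
  move=> ltk Q /(fP _ ltk)[i lti ->]; exists i; first exact: ltn_addr.
  by rewrite lti.
have [z pz zP] := prime_avoidance m f ip.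
exists z => // k ltk u Jzu; apply: contrapT => Ju.
have [Q [aQ Qz]] := zero_divisor_assoc_prime nR (iJ _ ltk) Jzu Ju.
have [i lti Qi] := fP _ ltk _ aQ; case: aQ => pQ [v Qv].
apply: (zP i lti); rewrite -?Qi // => pQ'; apply: (notin_prime1 pQ).
rewrite Qv /colon /= mul1r; apply: depthJ ltk _ _ => y py.
by have := pQ' y py; rewrite Qv.
Qed.

End Noetherian.

(** * Regular sequences at a prime *)

Section LocalRegular.
Variables (R : comNzRingType) (p : set R).
Hypothesis p_prime : is_prime p.
Add Ring R_ring_local : (comNzRing_theory R).
Implicit Types (J : set R) (x y z u : R) (xs ys : seq R).

(** The contraction to [R] of the extension of [J] to the local ring of [R] at
    [p].  Working with it keeps all elements in [R]. *)
Definition sat J : set R := [set f | exists2 s, ~ p s & J (s * f)].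

Lemma sat_ideal J : is_ideal J -> is_ideal (sat J).
Proof.
move=> iJ; split=> [|f g [s ps Jf] [t pt Jg]|a f [s ps Jf]].
- by exists 1; [apply: notin_prime1 | rewrite mulr0; apply: ideal0].
- exists (s * t); first exact: notin_primeM.
  rewrite (_ : _ * _ = t * (s * f) + s * (t * g)); last by comring.
  by apply: idealD => //; apply: idealMl.
- by exists s => //; rewrite mulrCA; apply: idealMl.
Qed.

Lemma sub_sat J : J `<=` sat J.
Proof. by move=> f Jf; exists 1; [apply: notin_prime1 | rewrite mul1r]. Qed.

Lemma sat_cancel J s f : ~ p s -> sat J (s * f) -> sat J f.
Proof.
move=> ps [t pt Jf]; exists (t * s); first exact: notin_primeM.
by rewrite -mulrA.
Qed.

(** Regular sequences on the local ring of [R/J] at [p], given by numerators.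
    The condition that the sequence generates a proper ideal is automatic from
    [p x] as soon as [J] is contained in [p]. *)
Fixpoint lreg J xs : Prop :=
  if xs is x :: xs' then [/\ p x, nzd (sat J) x & lreg (adjoin1 J x) xs'] else True.

(** If [y * u = a * z] modulo [J], then [a] is killed by [z] modulo [y], so it is a
    multiple of [y], and [y] cancels. *)
Lemma nzd_swap J y z : is_ideal J ->
  nzd (sat J) y -> nzd (sat (adjoin1 J y)) z -> nzd (sat (adjoin1 J z)) y.
Proof.
move=> iJ nzy nzz u [s ps [a Ja]].
have [|t pt [b Jb]] := nzz a.
  exists 1; first exact: notin_prime1.
  exists (s * u); rewrite (_ : _ - _ = - (s * (y * u) - a * z)); last by comring.
  exact: idealN.
have [|r pr Jr] := nzy (t * s * u - b * z).
  apply: sub_sat; rewrite (_ : _ * _ =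
    t * (s * (y * u) - a * z) + z * (t * a - b * y)); last by comring.
  by apply: idealD => //; apply: idealMl.
exists (r * (t * s)); first by do 2!apply: notin_primeM => //.
exists (r * b); rewrite (_ : _ - _ = r * (t * s * u - b * z)) //; by comring.
Qed.

(** Having depth at least [2] does not depend on the first element: if [u] is
    killed by [p] modulo [x], then [y1 * u = a * x] with [a] killed by [p] modulo
    [y1], hence [a] is a multiple of [y1] because [y2] is regular modulo [y1],
    and cancelling [y1] shows that [u] is a multiple of [x]. *)
Lemma depth_transfer J x y1 y2 u : is_ideal J ->
    nzd (sat J) x -> p y1 -> nzd (sat J) y1 ->
    p y2 -> nzd (sat (adjoin1 J y1)) y2 ->
  (forall y, p y -> sat (adjoin1 J x) (y * u)) -> sat (adjoin1 J x) u.
Proof.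
move=> iJ nzx py1 nzy1 py2 nzy2 pu.
have [s ps [a Ja]] := pu _ py1; have [t pt [b Jb]] := pu _ py2.
have [|r pr [c Jc]] := nzy2 a.
  have [|w pw Jw] := nzx (t * y2 * a - s * y1 * b).
    apply: sub_sat; rewrite (_ : _ * _ =
      s * y1 * (t * (y2 * u) - b * x) - t * y2 * (s * (y1 * u) - a * x));
      last by comring.
    by apply: idealB => //; apply: idealMl.
  exists (w * t); first exact: notin_primeM.
  exists (w * s * b).
  rewrite (_ : _ - _ = w * (t * y2 * a - s * y1 * b)) //; by comring.
have [|w pw Jw] := nzy1 (r * s * u - c * x).
  apply: sub_sat; rewrite (_ : _ * _ =
    r * (s * (y1 * u) - a * x) + x * (r * a - c * y1)); last by comring.
  by apply: idealD => //; apply: idealMl.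
exists (w * (r * s)); first by do 2!apply: notin_primeM => //.
exists (w * c); rewrite (_ : _ - _ = w * (r * s * u - c * x)) //; by comring.
Qed.

(** Rees's exchange: dividing by one nonzerodivisor [x] of [p] shortens a regular
    sequence by at most one.  Choose [z] in [p] regular modulo [J], [J + (x)] and
    [J + (y1)]; induction modulo [y1], exchanging [z], yields a sequence starting
    with [z] and [y1]; induction modulo [z], exchanging [x], removes one element. *)
Lemma regular_exchange d J ys x : noetherian R -> is_ideal J ->
    size ys = d.+1 -> lreg J ys -> p x -> nzd (sat J) x ->
  exists2 zs, size zs = d & lreg (adjoin1 J x) zs.
Proof.
move=> nR; elim: d J ys x => [|d IHd] J ys x iJ; first by exists [::].
case: ys => [|y1 [|y2 ys]] //= [sz] [py1 nzy1 [py2 nzy2 regys]] px nzx.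
pose Js k := match k with 0%N => sat J | 1%N => sat (adjoin1 J x)
                     | _ => sat (adjoin1 J y1) end.
have [|k _|[|[|[|]]] //= _ u pu|z pz nzz] := @common_nzd R p 3 Js nR.
- exact: prime_ideal.
- by case: k => [|[|k]]; apply: sat_ideal => //; apply: adjoin1_ideal.
- exact/nzx/pu.
- exact: (depth_transfer iJ nzx py1 nzy1 py2 nzy2 pu).
- exact/nzy2/pu.
have nz0 := nzz 0%N isT; have nz1 := nzz 1%N isT; have nz2 := nzz 2%N isT.
rewrite /Js /= in nz0 nz1 nz2 => {nzz Js}.
have [|||||zs1 szs1 regzs1] := IHd (adjoin1 J y1) (y2 :: ys) z => //.
- exact: adjoin1_ideal.
- by rewrite /= sz.
have [|||||zs2 szs2 regzs2] := IHd (adjoin1 J z) (y1 :: zs1) x => //.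
- exact: adjoin1_ideal.
- by rewrite /= szs1.
- by split=> //; [apply: nzd_swap | rewrite adjoin1C].
- exact: nzd_swap.
exists (z :: zs2); first by rewrite /= szs2.
by split=> //; rewrite adjoin1C.
Qed.

End LocalRegular.

Section PrimeChains.
Variable R : comNzRingType.

(** Chains of primes of the local ring of [R/J] at [p]. *)
Definition chain_between (J p : set R) d : Prop := exists c : nat -> set R,
  [/\ forall i, (i <= d)%N -> is_prime (c i),
      forall i, (i < d)%N -> c i `<` c i.+1, J `<=` c 0%N & c d `<=` p].

End PrimeChains.

(** * Integral free extensions *)

Section FreeExtension.
Variables (A B : comNzRingType) (phi : {rmorphism A -> B}).
(** [B] is free over [phi A] with basis [e] and coordinate functions [c]; the
    coordinate [c i0] retracts [phi], as it sends [1] to [1]. *)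
Variables (T : finType) (e : T -> B) (c : T -> B -> A) (i0 : T).
Hypothesis cD : forall i, {morph c i : b b' / b + b'}.
Hypothesis cM : forall i a b, c i (phi a * b) = a * c i b.
Hypothesis cE : forall b, b = \sum_i phi (c i b) * e i.
Hypothesis c1 : c i0 1 = 1.
Hypothesis phi_integral : integralRange phi.
Implicit Types (J : set A) (p : set A) (q : set B).

Definition ext J : set B := ideal_gen (phi @` J).

Lemma extP J b : is_ideal J -> ext J b <-> forall i, J (c i b).
Proof.
move=> iJ; split=> [[n [a [g [gJ ->]]]] i | Jb].
  have c0 : c i 0 = 0 by rewrite -[0](mul0r 0) -(rmorph0 phi) cM mul0r.
  rewrite (big_morph (c i) (cD i) c0); apply: ideal_sum => // k _.
  by have [x Jx <-] := gJ k; rewrite mulrC cM; apply: idealMr.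
rewrite (cE b); apply: ideal_sum => [|i _]; first exact: ideal_gen_ideal.
apply: idealMr; first exact: ideal_gen_ideal.
by apply: ideal_gen_sub; exists (c i b).
Qed.

Lemma ext_ideal J : is_ideal (ext J). Proof. exact: ideal_gen_ideal. Qed.

Lemma ext_phi J a : is_ideal J -> ext J (phi a) <-> J a.
Proof.
move=> iJ; split=> [/(extP _ iJ)/(_ i0)|Ja]; last first.
  by apply: ideal_gen_sub; exists a.
by rewrite -[phi a]mulr1 cM c1 mulr1.
Qed.

Lemma ext_adjoin1 J x : is_ideal J -> ext (adjoin1 J x) = adjoin1 (ext J) (phi x).
Proof.
move=> iJ; have iext := ext_ideal J; apply/seteqP; split.
  apply: ideal_gen_min; first exact: adjoin1_ideal.
  move=> _ [f [a Ja] <-]; exists (phi a); rewrite -rmorphM -rmorphB.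
  by apply: ideal_gen_sub; exists (f - a * x).
move=> b [d Jb]; rewrite -(subrK (d * phi x) b); apply: idealD.
- exact: ext_ideal.
- move: Jb; apply: ideal_gen_min; first exact: ext_ideal.
  by move=> _ [f Jf <-]; apply: ideal_gen_sub; exists f => //; apply: adjoin1_sub.
- apply: idealMl; first exact: ext_ideal.
  by apply: ideal_gen_sub; exists x => //; apply: adjoin1_mem.
Qed.

Lemma preimage_prime q : is_prime q -> is_prime (phi @^-1` q).
Proof.
move=> pq; have iq := prime_ideal pq; split; rewrite /preimage /=.
- split=> [|x y|a x] /=.
  + by rewrite rmorph0; apply: ideal0.
  + by rewrite rmorphD; apply: idealD.
  + by rewrite rmorphM; apply: idealMl.
- by rewrite rmorph1; apply: notin_prime1.
- by move=> x y; rewrite rmorphM; apply: primeM.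
Qed.

Section OverPrime.
Variable q : set B.
Hypothesis q_prime : is_prime q.
Let p := phi @^-1` q.
Let p_prime : is_prime p := preimage_prime q_prime.

Lemma ext_preimage_sub : ext p `<=` q.
Proof. by apply: ideal_gen_min => [|_ [a pa <-]//]; apply: prime_ideal. Qed.

(** If all coordinates of [s] were in [p], then [s] would be in the extension of
    [p], which is contained in [q]. *)
Lemma notin_component s : ~ q s -> exists i, ~ p (c i s).
Proof.
move=> qs; apply: contrapT => /forallNP ps; apply/qs/ext_preimage_sub.
by apply/extP => [|i]; [apply: prime_ideal | apply: contrapT].
Qed.

(** Flatness: multiplication by [phi x] acts coordinatewise, and finitely many
    denominators in [A] have a common multiple. *)
Lemma ext_nzd J x : is_ideal J -> nzd (sat p J) x -> nzd (sat q (ext J)) (phi x).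
Proof.
move=> iJ nzx b [s qs /(extP _ iJ) Jb].
have /choice[r rP] : forall i, exists r, ~ p r /\ J (r * c i (s * b)).
  move=> i; have [|r pr Jr] := nzx (c i (s * b)); last by exists r.
  by apply: sub_sat => //; rewrite -cM mulrCA.
exists (phi (\prod_i r i) * s).
  apply: notin_primeM => //.
  by move=> /(prime_prod p_prime)[i _ pri]; have [] := rP i.
apply/extP => // i; rewrite -mulrA cM (bigD1 i) //= mulrAC; apply: idealMr => //.
by have [] := rP i.
Qed.

(** Faithful flatness of the local map from [A] at [p] to [B] at [q]. *)
Lemma sat_ext J u : is_ideal J -> sat q (ext J) (phi u) -> sat p J u.
Proof.
move=> iJ [s qs /(extP _ iJ) Ju]; have [i psi] := notin_component qs.
by exists (c i s) => //; have := Ju i; rewrite mulrC cM mulrC.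
Qed.

(** The fibre over [p] is zero-dimensional.  In an integral equation of [y], let
    [k] be the least index of a coefficient outside [p]: modulo the extension of
    [p] the equation reads [y ^+ k * s = 0], where [s] is congruent modulo [y] to
    this coefficient and so lies outside [q]. *)
Lemma power_in_ext y : q y -> exists k s, ~ q s /\ ext p (y ^+ k * s).
Proof.
move=> qy; have [P monP /rootP Py] := phi_integral y.
have exk : exists k, `[< ~ p P`_k >].
  exists (size P).-1; apply/asboolP; rewrite -lead_coefE (monicP monP).
  exact: notin_prime1.
have /asboolP pk := ex_minnP exk; case: ex_minnP pk => k /asboolP pk mink _.
pose Q := map_poly phi P; pose s := (drop_poly k Q).[y].
have iq := prime_ideal q_prime.
exists k, s; split.
  move=> qs; apply: pk; rewrite /p /preimage /= -coef_map -/Q.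
  have -> : Q`_k = s - (drop_poly 1 (drop_poly k Q)).[y] * y.
    have take1 (D : {poly B}) : take_poly 1 D = (D`_0)%:P.
      apply/polyP => j; rewrite coef_take_poly coefC ltnS leqn0.
      by case: eqP => // ->.
    rewrite /s -[in X in X - _](poly_take_drop 1 (drop_poly k Q)) take1.
    by rewrite coef_drop_poly hornerD hornerM hornerC hornerXn expr1 addrK.
  by apply: idealB => //; apply: idealMl.
have -> : y ^+ k * s = - (take_poly k Q).[y].
  apply/eqP; rewrite -addr_eq0 addrC mulrC -hornerXn -hornerM -hornerD.
  by rewrite poly_take_drop Py.
apply: idealN; first exact: ext_ideal.
rewrite horner_coef; apply: ideal_sum => [|j _]; first exact: ext_ideal.
apply: idealMr; first exact: ext_ideal.
rewrite coef_take_poly; case: ifP => [ltjk|_]; last by apply: ideal0; apply: ext_ideal.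
rewrite coef_map; apply: ideal_gen_sub; exists P`_j => //.
by apply: contrapT => /asboolP/mink; rewrite leqNgt ltjk.
Qed.

Lemma lreg_ext J xs : is_ideal J ->
  lreg p J xs -> lreg q (ext J) [seq phi x | x <- xs].
Proof.
elim: xs J => [|x xs IHxs] //= J iJ [px nzx regxs]; split=> //.
  exact: ext_nzd.
by rewrite -ext_adjoin1 //; apply: IHxs => //; apply: adjoin1_ideal.
Qed.

(** A first nonzerodivisor [y] in [q] yields one in [p]: an element [u] killed by
    [p] modulo [J] would be killed by a power of [y], by the previous description
    of the fibre.  If [x] is a nonzerodivisor in [p], exchange gives a regular
    sequence one shorter modulo [phi x], and the induction goes on modulo [x]. *)
Lemma lreg_descent J ys : noetherian A -> noetherian B -> is_ideal J ->
  lreg q (ext J) ys -> exists2 xs, size xs = size ys & lreg p J xs.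
Proof.
move=> nA nB; move szys: (size ys) => k.
elim: k J ys szys => [|k IHk] J ys; first by exists [::].
case: ys => [|y ys] //= [szys] iJ [qy nzy regys].
have [|m _|[|]// _ u pu|x px nzx] := @common_nzd A p 1 (fun=> sat p J) nA.
- exact: prime_ideal.
- exact: sat_ideal.
- apply: sat_ext => //; have [m [s [qs yms]]] := power_in_ext qy.
  apply: (sat_cancel q_prime qs); have {yms} : sat q (ext J) (y ^+ m * (s * phi u)).
    rewrite mulrA; move: (yms).
    apply: (@ideal_gen_min _ _ (colon (sat q (ext J)) (phi u))).
      by apply/colon_ideal/sat_ideal => //; apply: ext_ideal.
    move=> _ [a pa <-]; rewrite /colon /= -rmorphM.
    have [t pt Jt] := pu a pa; exists (phi t) => //.
    by rewrite -rmorphM; apply/ext_phi.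
  by elim: m => [|m IHm]; rewrite ?mul1r // exprS -mulrA => /nzy.
have {}nzx := nzx 0%N isT.
have [||||zs szs regzs] := @regular_exchange B q q_prime k (ext J) (y :: ys)
  (phi x) nB (ext_ideal J).
- by rewrite /= szys.
- by split.
- exact: px.
- exact: ext_nzd.
rewrite -ext_adjoin1 // in regzs.
have [|||xs szxs regxs] := IHk (adjoin1 J x) zs => //.
- exact: adjoin1_ideal.
by exists (x :: xs); rewrite /= ?szxs.
Qed.

(** A prime containing the extension of [p'] and disjoint from the products
    [phi a * s] with [a] outside [p'] and [s] outside [q] lies below [q] and
    contracts to [p']. *)
Lemma going_down p' : noetherian B -> is_prime p' -> p' `<=` p ->
  exists q', [/\ is_prime q', q' `<=` q & phi @^-1` q' = p'].
Proof.
move=> nB pp' p'p; have ip' := prime_ideal pp'.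
pose S b := exists a s, [/\ ~ p' a, ~ q s & b = phi a * s].
have [|||b [a [s [p'a qs ->]]] /(extP _ ip') pc|Q [pQ extQ SQ]] :=
  @exists_prime_disjoint B S (ext p') nB.
- exact: ext_ideal.
- exists 1, 1; rewrite rmorph1 mulr1; split=> //; exact: notin_prime1.
- move=> _ _ [a [s [p'a qs ->]]] [b [t [p'b qt ->]]].
  exists (a * b), (s * t); split; [exact: notin_primeM..|].
  by rewrite rmorphM mulrACA.
- have [i psi] := notin_component qs; apply: psi.
  by have := pc i; rewrite cM => /(primeM pp')[//|/p'p].
exists Q; split=> //.
  move=> b Qb; apply: contrapT => qb; apply: (SQ b) => //.
  exists 1, b; rewrite rmorph1 mul1r; split=> //; exact: notin_prime1.
apply/seteqP; split=> [a Qa|a pa]; last first.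
  by apply: extQ; apply/ext_phi.
apply: contrapT => p'a; apply: (SQ (phi a)) => //.
exists a, 1; rewrite mulr1; split=> //; exact: notin_prime1.
Qed.

End OverPrime.

Lemma incomparable q1 q2 : is_prime q1 -> is_prime q2 -> q1 `<=` q2 ->
  phi @^-1` q2 `<=` phi @^-1` q1 -> q2 `<=` q1.
Proof.
move=> pq1 pq2 q12 sub y q2y; have [k [s [q2s ys]]] := power_in_ext pq2 q2y.
have : q1 (y ^+ k * s).
  by move: ys; apply: ideal_gen_min; [apply: prime_ideal | move=> _ [a /sub pa <-]].
by case/(primeM pq1) => [/(prime_exp pq1)//|/q12].
Qed.

Lemma lying_over p : noetherian B -> is_prime p ->
  exists2 q, is_prime q & phi @^-1` q = p.
Proof.
move=> nB pp; have ip := prime_ideal pp.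
pose S b := exists2 a, ~ p a & b = phi a.
have [|||_ [a pa ->] /(ext_phi _ ip)//|Q [pQ extQ SQ]] :=
  @exists_prime_disjoint B S (ext p) nB.
- exact: ext_ideal.
- by exists 1; rewrite ?rmorph1 //; apply: notin_prime1.
- move=> _ _ [a pa ->] [b pb ->]; exists (a * b); rewrite ?rmorphM //.
  exact: notin_primeM.
exists Q => //; apply/seteqP; split=> a Qa.
  by apply: contrapT => pa; apply: (SQ (phi a)) => //; exists a.
by apply: extQ; apply/ext_phi.
Qed.

(** Contracting a chain keeps it strict by incomparability; a chain below [p] is
    lifted from the top by going down. *)
Lemma chain_between_ext J q d : noetherian B -> is_ideal J -> is_prime q ->
  chain_between J (phi @^-1` q) d <-> chain_between (ext J) q d.
Proof.
move=> nB iJ pq; split=> [[C [pC ltC JC Cq]] | [C [pC ltC JC Cq]]]; last first.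
  exists (fun i => phi @^-1` C i); split.
  - by move=> i /pC; apply: preimage_prime.
  - move=> i ltid; have [sub nsub] := ltC i ltid.
    split=> [a /sub//|sub']; apply: nsub.
    by apply: incomparable => //; apply: pC => //; apply: ltnW.
  - by move=> a Ja; apply: JC; apply: ideal_gen_sub; exists a.
  - by move=> a /Cq.
suff [C' [pC' eqC' leC' C'q]] : exists C' : nat -> set B,
    [/\ forall i, (i <= d)%N -> is_prime (C' i),
        forall i, (i <= d)%N -> phi @^-1` (C' i) = C i,
        forall i, (i < d)%N -> C' i `<=` C' i.+1 & C' d `<=` q].
  exists C'; split=> // [i ltid|].
    split; first exact: leC'.
    move=> sub; have [_] := ltC i ltid; apply.
    by rewrite -!eqC' ?(ltnW ltid) // => a /sub.
  apply: ideal_gen_min; first exact/prime_ideal/pC'.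
  by move=> _ [a Ja <-]; move: (JC a Ja); rewrite -eqC'.
elim: d q pq pC ltC Cq {JC} => [|d IHd] q pq pC ltC Cq.
  have [q' [pq' q'q q'C]] := going_down pq nB (pC 0%N isT) Cq.
  by exists (fun=> q'); split=> // i; rewrite leqn0 => /eqP ->.
have [q' [pq' q'q q'C]] := going_down pq nB (pC d.+1 (leqnn _)) Cq.
have [|||C' [pC' eqC' leC' C'q]] := IHd q' pq'.
- by move=> i leid; apply/pC/leqW.
- by move=> i ltid; apply/ltC/leqW.
- by have [sub _] := ltC d (leqnn _); rewrite q'C.
exists (fun i => if (i <= d)%N then C' i else q'); split.
- by move=> i _; case: ifP => // /pC'.
- move=> i; case: ifP => [leid _|]; first exact: eqC'.
  move=> /negbT; rewrite -ltnNge => ltdi leid.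
  by rewrite (@anti_leq i d.+1) ?leid.
- move=> i; rewrite ltnS => leid; rewrite leid; case: ifP => [|/negbT].
    exact: leC'.
  by rewrite -leqNgt => ledi; rewrite (@anti_leq i d) ?leid.
- by rewrite ltnn.
Qed.

End FreeExtension.

(** * Hilbert's basis theorem *)

Section HilbertBasis.

Section Polynomials.
Variable R : comNzRingType.
Implicit Types (J : set {poly R}).

Definition lead_coefs J n : set R :=
  [set a | exists f, [/\ J f, (size f <= n.+1)%N & f`_n = a]].

Lemma lead_coefs_ideal J n : is_ideal J -> is_ideal (lead_coefs J n).
Proof.
move=> iJ; split=> [|a b [f [Jf szf <-]] [g [Jg szg <-]]|a b [f [Jf szf <-]]].
- by exists 0; rewrite size_poly0 coef0; split=> //; apply: ideal0.
- exists (f + g); rewrite coefD; split=> //; first exact: idealD.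
  by apply: leq_trans (size_polyD _ _) _; rewrite geq_max szf.
- exists (a%:P * f); rewrite coefCM; split=> //; first exact: idealMl.
  by rewrite mul_polyC; apply: leq_trans (size_scale_leq _ _) szf.
Qed.

Lemma lead_coefs_mono J n m :
  is_ideal J -> (n <= m)%N -> lead_coefs J n `<=` lead_coefs J m.
Proof.
move=> iJ lenm a [f [Jf szf <-]]; exists (f * 'X^(m - n)).
split; first exact: idealMr.
  have [->|f0] := eqVneq f 0; first by rewrite mul0r size_poly0.
  by rewrite size_mulXn // -[X in (_ <= X.+1)%N](subnK lenm) -addnS leq_add2l.
by rewrite coefMXn ltnNge leq_subr /= subKn.
Qed.

Lemma lead_coefsS J J' n : J `<=` J' -> lead_coefs J n `<=` lead_coefs J' n.
Proof. by move=> sub a [f [Jf szf <-]]; exists f; split=> //; apply: sub. Qed.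

Lemma lead_coefs_sub J J' : is_ideal J -> is_ideal J' -> J `<=` J' ->
  (forall n, lead_coefs J' n `<=` lead_coefs J n) -> J' `<=` J.
Proof.
move=> iJ iJ' JJ' lcs f; have [k] := ubnP (size f).
elim: k f => // k IHk f ltk J'f; have [->|f0] := eqVneq f 0.
  exact: ideal0.
have sz := polySpred f0; have [|g [Jg szg gf]] := lcs (size f).-1 f`_(size f).-1.
  by exists f; split=> //; rewrite -sz.
rewrite -(subrK g f); apply: idealD => //; apply: IHk.
  rewrite ltnS in ltk; apply: leq_trans ltk; rewrite sz ltnS.
  apply/leq_sizeP => j; rewrite leq_eqVlt coefB => /orP[/eqP <-|ltj].
    by rewrite gf subrr.
  rewrite !nth_default ?subrr //; first exact: leq_trans szg _.
  by rewrite sz.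
by apply: idealB => //; apply: JJ'.
Qed.

(** First take a maximal ideal among all the [lead_coefs J n], reached at [J0] and
    [n0]; then enlarge [J0] finitely often so that its ideals of leading
    coefficients in degrees below [n0] are maximal too.  The resulting ideal is
    maximal in the family, as an ideal is determined within a larger one by its
    leading coefficients. *)
Lemma noetherian_poly : noetherian R -> noetherian {poly R}.
Proof.
move=> nR C [J1 CJ1] Cideal.
pose D (I : set R) := exists J n, C J /\ I = lead_coefs J n.
have [||_ [J0 [n0 [CJ0 ->]]] max0] := nR D.
- by exists (lead_coefs J1 0), J1, 0%N.
- by move=> _ [J [n [CJ ->]]]; apply/lead_coefs_ideal/Cideal.
have /(_ n0)[M [CM J0M maxM]] : forall k, exists M, [/\ C M, J0 `<=` M & forall J, C J ->
    M `<=` J -> forall n, (n < k)%N -> lead_coefs J n `<=` lead_coefs M n].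
  elim=> [|k [M [CM J0M maxM]]]; first by exists J0; split.
  pose E (I : set R) := exists J, [/\ C J, M `<=` J & I = lead_coefs J k].
  have [||_ [M' [CM' MM' ->]] maxM'] := nR E.
  - by exists (lead_coefs M k), M; split.
  - by move=> _ [J [CJ _ ->]]; apply/lead_coefs_ideal/Cideal.
  exists M'; split=> // [|J CJ M'J n]; first exact: subset_trans J0M MM'.
  rewrite ltnS leq_eqVlt => /orP[/eqP ->|ltnk].
    apply: maxM'; last exact: lead_coefsS.
    by exists J; split=> //; apply: subset_trans MM' M'J.
  apply: (subset_trans _ (lead_coefsS MM')); apply: maxM => //.
  exact: subset_trans MM' M'J.
exists M => // J CJ MJ; apply: lead_coefs_sub; [exact: Cideal..|by []|].
move=> n; have [ltn|len] := ltnP n n0; first exact: maxM.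
have step : lead_coefs J0 n0 `<=` lead_coefs J n.
  apply: (subset_trans _ (lead_coefsS (subset_trans J0M MJ))).
  by apply: lead_coefs_mono => //; apply: Cideal.
apply: (subset_trans (max0 _ _ step)); first by exists J, n.
apply: (subset_trans _ (lead_coefsS J0M)).
by apply: lead_coefs_mono => //; apply: Cideal.
Qed.

End Polynomials.

(** Used to reach [K[t_1, ..., t_(n+1)]] from [K[t_1, ..., t_n][X]], evaluating
    [X] at the last variable. *)
Lemma noetherian_surj (R S : comNzRingType) (f : {rmorphism R -> S}) :
  (forall y, exists x, f x = y) -> noetherian R -> noetherian S.
Proof.
move=> surj nR C [J0 CJ0] Cideal.
pose D (I : set R) := exists2 J, C J & I = f @^-1` J.
have [||_ [M CM ->] maxM] := nR D.
- by exists (f @^-1` J0), J0.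
- move=> _ [J /Cideal iJ ->]; split=> [|x y|a x]; rewrite /preimage /=.
  + by rewrite rmorph0; apply: ideal0.
  + by rewrite rmorphD; apply: idealD.
  + by rewrite rmorphM; apply: idealMl.
exists M => // J CJ MJ y; have [x <-] := surj y.
by apply: (maxM (f @^-1` J)); [exists J | move=> z; apply: MJ].
Qed.

Lemma noetherian_field (K : fieldType) : noetherian K.
Proof.
move=> C [J0 CJ0] Cideal.
have [[J [CJ [x Jx x0]]]|nox] := pselect (exists J, C J /\ exists2 x, J x & x != 0).
  exists J => // I CI JI y _; rewrite -(divfK x0 y).
  by apply: idealMl => //; apply: Cideal.
exists J0 => // J CJ _ x Jx; have [->|x0] := eqVneq x 0.
  by apply: ideal0; apply: Cideal.
by case: nox; exists J; split=> //; exists x.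
Qed.

Lemma noetherian_mpoly (K : fieldType) n : noetherian {mpoly K[n]}.
Proof.
elim: n => [|n IHn].
  apply: (@noetherian_surj _ _ (@mpolyC 0 K)); last exact: noetherian_field.
  by move=> f; exists (f@_0%MM); exact: esym (nvar0_mpolyC f).
have cX : commr_rmorph (@mwiden n K) 'X_ord_max by move=> f; apply: mulrC.
apply: (@noetherian_surj _ _ (horner_morph cX)); last exact: noetherian_poly.
pose im y := exists x, horner_morph cX x = y.
move=> f; rewrite -/(im f) [f]mpolyE; elim/big_ind: _ => [|_ _ [x <-] [y <-]|m _].
- by exists 0; rewrite rmorph0.
- by exists (x + y); rewrite rmorphD.
suff [x xm] : im 'X_[m].
  exists ((f@_m)%:MP%:P * x).
  by rewrite rmorphM /= xm horner_morphC /= mwidenC mul_mpolyC.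
rewrite mpolyXE_id; elim/big_ind: _ => [|_ _ [x <-] [y <-]|i _].
- by exists 1; rewrite rmorph1.
- by exists (x * y); rewrite rmorphM.
suff [x <-] : im 'X_i.
  by exists (x ^+ m i); rewrite rmorphXn.
have [j ->|->] := unliftP ord_max i; last first.
  by exists 'X; rewrite horner_morphX.
exists ('X_j)%:P; rewrite horner_morphC /= mwidenX mnmwiden1; congr 'X_[U_(_)].
by apply: val_inj; rewrite /= /bump leqNgt ltn_ord.
Qed.

End HilbertBasis.

(** * Regular sequences and primes in a localization *)

Section QuotientRegular.
Variable R : comNzRingType.
Implicit Types (J : set R) (x y : R) (xs : seq R).

(** The recursive form of a regular sequence, convenient for induction: each step
    replaces [J] by [J + (x)]. *)
Fixpoint plain_regular J xs : Prop :=
  if xs is x :: xs' then nzd J x /\ plain_regular (adjoin1 J x) xs' else True.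

Lemma ideal_adjoin_nil J : is_ideal J -> ideal_adjoin J [::] = J.
Proof.
move=> iJ; apply/seteqP; split; last by move=> x Jx; apply: ideal_gen_sub; left.
by apply: ideal_gen_min => // x [].
Qed.

Lemma ideal_adjoin_cons J x xs :
  is_ideal J -> ideal_adjoin J (x :: xs) = ideal_adjoin (adjoin1 J x) xs.
Proof.
move=> iJ; apply/seteqP; split; apply: ideal_gen_min; try exact: ideal_gen_ideal.
  move=> y [Jy|]; first by apply: ideal_gen_sub; left; apply: adjoin1_sub.
  rewrite /= in_cons => /orP[/eqP ->|xsy]; apply: ideal_gen_sub; last by right.
  by left; apply: adjoin1_mem.
move=> y [[a Ja]|xsy]; last by apply: ideal_gen_sub; right; rewrite /= in_cons xsy orbT.
rewrite -(subrK (a * x) y); apply: idealD; first exact: ideal_gen_ideal.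
  by apply: ideal_gen_sub; left.
apply: idealMl; first exact: ideal_gen_ideal.
by apply: ideal_gen_sub; right; rewrite /= mem_head.
Qed.

Lemma quo_regularE J xs : is_ideal J ->
  quo_regular J xs <-> plain_regular J xs /\ ~ ideal_adjoin J xs 1.
Proof.
move=> iJ; rewrite /quo_regular.
suff : (forall i, (i < size xs)%N -> forall y,
    ideal_adjoin J (take i xs) (xs`_i * y) -> ideal_adjoin J (take i xs) y)
    <-> plain_regular J xs by move=> e; split=> -[/e].
elim: xs J iJ => [|x xs IHxs] J iJ; first by split.
have iadj := adjoin1_ideal x iJ; split=> [reg | [nzx /(IHxs _ iadj) reg] [_ y|i lti y]].
- split=> [y|]; first by have := reg 0%N isT y; rewrite /= ideal_adjoin_nil.
  apply/IHxs => // i lti y; have := reg i.+1 lti y.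
  by rewrite /= ideal_adjoin_cons.
- by rewrite /= ideal_adjoin_nil //; apply: nzx.
- by rewrite /= ideal_adjoin_cons //; apply: reg.
Qed.

End QuotientRegular.

Section LocalizationAtPrime.
Variables (R : idomainType) (p : prime_idealr R).
Local Notation L := (localization p).
Local Notation P := (pset p).
Local Notation loc := (to_loc p).
Implicit Types (I Q : set R) (x y : L) (a b s : R).

Let pP : is_prime P := psetP p.

Fact to_loc_zmod_morphism : zmod_morphism loc.
Proof. by move=> a b; apply: val_inj; rewrite /= rmorphB. Qed.

Fact to_loc_monoid_morphism : monoid_morphism loc.
Proof.
by split=> [|a b]; apply: val_inj; rewrite /= ?rmorph1 ?rmorphM.
Qed.

HB.instance Definition _ :=
  GRing.isZmodMorphism.Build R L loc to_loc_zmod_morphism.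
HB.instance Definition _ :=
  GRing.isMonoidMorphism.Build R L loc to_loc_monoid_morphism.

Lemma to_loc_inj : injective loc.
Proof. by move=> a b /(congr1 val) /= /eqP; rewrite tofrac_eq => /eqP. Qed.

Lemma to_loc_inv s : ~ P s -> exists x, x * loc s = 1.
Proof.
move=> /negP ps; have s1 := loc_predP 1 ps.
exists (Localize s1); apply: val_inj => /=.
by rewrite tofrac1 mul1r mulVf ?(loc_den_neq0 ps).
Qed.

Lemma loc_fraction x : exists a s, ~ P s /\ x * loc s = loc a.
Proof.
case: x => x xp; have /asboolP[a [s [ps xE]]] := xp.
exists a, s; split; first exact/negP.
by apply: val_inj; rewrite /= xE divfK // (loc_den_neq0 ps).
Qed.

(** An ideal of the localization is determined by numerators, and those of the
    extension of [I] are the elements of [sat P I]. *)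
Lemma ideal_locP I x a s : is_ideal I -> ~ P s -> x * loc s = loc a ->
  ideal_loc p I x <-> sat P I a.
Proof.
move=> iI ps xs; split=> [Ix|[t pt Ia]]; last first.
  have [y yst] := to_loc_inv (notin_primeM pP ps pt).
  have -> : x = y * loc (t * a).
    rewrite rmorphM /= -xs -[LHS]mulr1 -yst rmorphM /= mulrCA; congr (y * _).
    by rewrite [RHS]mulrCA [loc t * _]mulrC.
  apply: idealMl; first exact: ideal_gen_ideal.
  by apply: ideal_gen_sub; exists (t * a).
pose F : set L :=
  [set y | exists b t, [/\ I b, ~ P t & y * loc t = loc b]].
have [b [t [Ib pt xt]]] : F x.
  move: Ix; apply: (@ideal_gen_min _ _ F); last first.
    move=> _ [b Ib <-]; exists b, 1; rewrite rmorph1 mulr1; split=> //.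
    exact: notin_prime1.
  split=> [|y z [b [t [Ib pt yt]]] [c [u [Ic pu zu]]]|y z [b [t [Ib pt zt]]]].
  - exists 0, 1; rewrite mul0r rmorph0; split=> //; first exact: ideal0.
    exact: notin_prime1.
  - exists (b * u + c * t), (t * u); split.
    + by apply: idealD => //; apply: idealMr.
    + exact: notin_primeM.
    + rewrite !(rmorphD, rmorphM) /= -yt -zu mulrDl mulrA; congr (_ + _).
      by rewrite -!mulrA [loc t * _]mulrC.
  - have [c [u [pu yu]]] := loc_fraction y.
    exists (c * b), (u * t); split; [exact: idealMl | exact: notin_primeM |].
    by rewrite !rmorphM /= -yu -zt mulrACA.
exists t => //; rewrite (_ : t * a = b * s); first exact: idealMr.
by apply: to_loc_inj; rewrite !rmorphM /= -xs -xt mulrCA mulrA.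
Qed.

Lemma ideal_loc_to_loc I a : is_ideal I -> ideal_loc p I (loc a) <-> sat P I a.
Proof.
move=> iI; apply: (@ideal_locP _ _ _ 1) => //; first exact: notin_prime1.
by rewrite rmorph1 mulr1.
Qed.

Lemma ideal_mul_loc (J : set L) x s : is_ideal J -> ~ P s ->
  J (x * loc s) <-> J x.
Proof.
move=> iJ ps; split=> [|Jx]; last exact: idealMr.
have [y ys] := to_loc_inv ps => Jxs.
by rewrite -[x]mulr1 -ys [y * _]mulrC mulrA; apply: idealMr.
Qed.

Lemma adjoin1_ideal_loc I x a s : is_ideal I -> ~ P s -> x * loc s = loc a ->
  adjoin1 (ideal_loc p I) x = ideal_loc p (adjoin1 I a).
Proof.
move=> iI ps xs; have iL J : is_ideal (ideal_loc p J) by apply: ideal_gen_ideal.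
have iadj := adjoin1_ideal x (iL I).
apply/seteqP; split=> [y [z Iy]|]; last first.
  apply: ideal_gen_min => // _ [f [b Ifb] <-].
  rewrite -(subrK (loc b * loc a) (loc f)); apply: idealD => //.
    by apply: adjoin1_sub => //; rewrite -rmorphM -rmorphB; apply: ideal_gen_sub;
      exists (f - b * a).
  by apply: idealMl => //; rewrite -xs; apply: idealMr => //; apply: adjoin1_mem.
rewrite -(subrK (z * x) y); apply: idealD => //.
  move: Iy; apply: ideal_gen_min => // _ [f If <-]; apply: ideal_gen_sub.
  by exists f => //; apply: adjoin1_sub.
apply: idealMl => //; apply/(ideal_mul_loc _ _ ps) => //; rewrite xs.
by apply: ideal_gen_sub; exists a => //; apply: adjoin1_mem.
Qed.

Lemma nzd_ideal_loc I x a s : is_ideal I -> ~ P s -> x * loc s = loc a ->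
  nzd (ideal_loc p I) x <-> nzd (sat P I) a.
Proof.
move=> iI ps xs; have iL : is_ideal (ideal_loc p I) by apply: ideal_gen_ideal.
split=> [nzx b Iab | nza y Ixy].
  apply/ideal_loc_to_loc => //; apply: nzx; apply/(ideal_mul_loc _ _ ps) => //.
  by rewrite mulrAC xs -rmorphM; apply/ideal_loc_to_loc.
have [b [t [pt yt]]] := loc_fraction y.
apply/(ideal_locP iI pt yt); apply: nza.
have xyst : x * y * loc (s * t) = loc (a * b).
  by rewrite !rmorphM /= -xs -yt mulrACA.
exact/(ideal_locP iI (notin_primeM pP ps pt) xyst).
Qed.

Lemma ideal_locS I Q : I `<=` Q -> ideal_loc p I `<=` ideal_loc p Q.
Proof.
move=> IQ; apply: ideal_gen_min; first exact: ideal_gen_ideal.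
by move=> _ [a Ia <-]; apply: ideal_gen_sub; exists a => //; apply: IQ.
Qed.

Lemma sat_prime Q : is_prime Q -> Q `<=` P -> sat P Q = Q.
Proof.
move=> pQ QP; apply/seteqP; split; last exact: sub_sat.
by move=> a [s ps /(primeM pQ)[/QP|]].
Qed.

Lemma ideal_loc_prime Q : is_prime Q -> Q `<=` P -> is_prime (ideal_loc p Q).
Proof.
move=> pQ QP; have iQ := prime_ideal pQ; split; first exact: ideal_gen_ideal.
  rewrite -[1](rmorph1 loc) => /(ideal_loc_to_loc _ iQ).
  by rewrite sat_prime //; apply: notin_prime1.
move=> x y; have [a [s [ps xs]]] := loc_fraction x.
have [b [t [pt yt]]] := loc_fraction y.
have xyst : x * y * loc (s * t) = loc (a * b).
  by rewrite !rmorphM /= -xs -yt mulrACA.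
move/(ideal_locP iQ (notin_primeM pP ps pt) xyst); rewrite sat_prime //.
by case/(primeM pQ) => Qab; [left | right]; [apply/(ideal_locP iQ ps xs)
  | apply/(ideal_locP iQ pt yt)]; rewrite sat_prime.
Qed.

(** Elements of a regular sequence may be multiplied by units, so every regular
    sequence in the local ring can be replaced by its numerators. *)
Lemma quo_regular_loc I k : is_ideal I -> I `<=` P ->
  (exists xs : seq L, [/\ size xs = k,
     forall x, x \in xs -> ideal_loc p P x & quo_regular (ideal_loc p I) xs])
  <-> exists2 r, size r = k & lreg P I r.
Proof.
move=> iI IP; have iP := prime_ideal pP.
have iL J : is_ideal (ideal_loc p J) by apply: ideal_gen_ideal.
split=> [[xs [<- xsm /(quo_regularE _ (iL I))[regxs _]]] | [r <- regr]].
  elim: xs I iI {IP} xsm regxs => [|x xs IHxs] I iI xsm; first by exists [::].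
  case=> nzx regxs; have [a [s [ps xs_]]] := loc_fraction x.
  have [|y||r szr regr] := IHxs (adjoin1 I a).
  - exact: adjoin1_ideal.
  - by move=> xsy; apply: xsm; rewrite in_cons xsy orbT.
  - by rewrite -(adjoin1_ideal_loc iI ps xs_).
  exists (a :: r); rewrite /= ?szr //; split=> //.
    have /(ideal_locP iP ps xs_) := xsm x (mem_head _ _).
    by rewrite sat_prime.
  exact/(nzd_ideal_loc iI ps xs_).
have p1 : ~ P 1 by apply: notin_prime1.
have loc1 a : loc a * loc 1 = loc a by rewrite rmorph1 mulr1.
have rP : forall a, a \in r -> P a.
  elim: r I {iI IP} regr => [|a r IHr] I //= [pa _ regr] b.
  by rewrite in_cons => /orP[/eqP -> //|]; apply: IHr regr b.
have rm x : x \in [seq loc a | a <- r] -> ideal_loc p P x.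
  by case/mapP => a /rP pa ->; apply: ideal_gen_sub; exists a.
exists [seq loc a | a <- r]; split=> //; first by rewrite size_map.
apply/quo_regularE => //; split; last first.
  have pm : is_prime (ideal_loc p P) by apply: ideal_loc_prime.
  move=> one; apply: (notin_prime1 pm); move: one.
  apply: ideal_gen_min => // x [|/rm//]; exact: ideal_locS.
elim: r I iI {IP rP rm} regr => [|a r IHr] I iI //= [pa nza regr].
split; first exact/(nzd_ideal_loc iI p1 (loc1 a)).
by rewrite (adjoin1_ideal_loc iI p1 (loc1 a)); apply: IHr => //; apply: adjoin1_ideal.
Qed.

(** Primes of the localization correspond to the primes of [R] contained in [p]. *)
Lemma prime_chain_loc I k : is_ideal I ->
  (exists2 c : nat -> prime_idealr L, prime_chain c k &
     ideal_loc p I `<=` pset (c 0%N)) <-> chain_between I P k.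
Proof.
move=> iI; split=> [[c ltc Ic] | [C [pC ltC IC CP]]].
  exists (fun i => loc @^-1` pset (c i)); split.
  - by move=> i _; apply: preimage_prime; apply: psetP.
  - move=> i /ltc[sub nsub]; split=> [a /sub//|sub']; apply: nsub => x cx.
    have [a [s [ps xs]]] := loc_fraction x.
    have ic j := prime_ideal (psetP (c j)).
    apply/(ideal_mul_loc _ (ic i) ps); rewrite xs; apply: sub'.
    by rewrite /preimage /= -xs; apply: idealMr.
  - by move=> a Ia; apply: Ic; apply: ideal_gen_sub; exists a.
  - move=> a ca; apply: contrapT => /to_loc_inv[x xa].
    apply: (notin_prime1 (psetP (c k))); rewrite -xa.
    by apply: idealMl => //; apply: prime_ideal (psetP _).
have leC i j : (i <= j <= k)%N -> C i `<=` C j.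
  move=> /andP[/subnK <-]; elim: (j - i)%N => [|n IHn] ltk; first by [].
  apply: (@subset_trans _ (C (n + i)%N)); first exact/IHn/ltnW.
  by have [] := ltC _ ltk.
(* A chain of length k is indexed by all naturals; it is continued constantly
   beyond k. *)
have CmP i : C (minn i k) `<=` P.
  by apply: subset_trans CP; apply: leC; rewrite geq_minr leqnn.
have pCm i : is_prime (C (minn i k)) by apply: pC; apply: geq_minr.
have /choice[c cE] i : exists c : prime_idealr L,
    pset c = ideal_loc p (C (minn i k)).
  by apply: prime_idealr_of; apply: ideal_loc_prime.
exists c; last by rewrite cE min0n; apply: ideal_locS.
move=> i ltik; rewrite !cE; have [sub nsub] := ltC i ltik.
have [Ei ESi] : minn i k = i /\ minn i.+1 k = i.+1.
  by split; apply/minn_idPl => //; apply: ltnW.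
split; first by rewrite Ei ESi; apply: ideal_locS.
move=> sub'; apply: nsub => a Ca.
have : sat P (C (minn i k)) a.
  apply/ideal_loc_to_loc; first exact: prime_ideal.
  by apply: sub'; apply: ideal_gen_sub; exists a; rewrite ?ESi.
by rewrite sat_prime // Ei.
Qed.

Lemma quo_local_CME I : is_ideal I -> I `<=` P ->
  quo_local_CM (ideal_loc p P) (ideal_loc p I) <->
  exists2 d, is_max [set k | chain_between I P k] d &
    is_max [set k | exists2 r, size r = k & lreg P I r] d.
Proof.
move=> iI IP; rewrite /quo_local_CM /quo_krull_dim /quo_depth.
set D := [set k | exists2 _, _ & _]; set E := [set k | exists _, _].
rewrite (_ : D = [set k | chain_between I P k]); last first.
  by apply/seteqP; split=> k; apply: (prime_chain_loc k iI).1
    || apply: (prime_chain_loc k iI).2.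
rewrite (_ : E = [set k | exists2 r, size r = k & lreg P I r]) //.
by apply/seteqP; split=> k; [apply: (quo_regular_loc k iI IP).1
  | apply: (quo_regular_loc k iI IP).2].
Qed.

End LocalizationAtPrime.

(** * Cohen-Macaulayness along an integral free extension *)

Section CohenMacaulayExtension.
Variables (A B : idomainType) (phi : {rmorphism A -> B}).
Variables (T : finType) (e : T -> B) (c : T -> B -> A) (i0 : T).
Hypothesis cD : forall i, {morph c i : b b' / b + b'}.
Hypothesis cM : forall i a b, c i (phi a * b) = a * c i b.
Hypothesis cE : forall b, b = \sum_i phi (c i b) * e i.
Hypothesis c1 : c i0 1 = 1.
Hypothesis phi_integral : integralRange phi.
Hypotheses (nA : noetherian A) (nB : noetherian B).

Lemma quo_local_CM_ext (I : set A) (p : prime_idealr A) (q : prime_idealr B) :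
    is_ideal I -> I `<=` pset p -> phi @^-1` pset q = pset p ->
  quo_local_CM (ideal_loc p (pset p)) (ideal_loc p I) <->
  quo_local_CM (ideal_loc q (pset q)) (ideal_loc q (ext phi I)).
Proof.
move=> iI Ip qp; have pq := psetP q.
have Iq : ext phi I `<=` pset q.
  apply: ideal_gen_min; first exact: prime_ideal.
  by move=> _ [a /Ip pa <-]; move: pa; rewrite -qp.
have ichain k : chain_between I (pset p) k <-> chain_between (ext phi I) (pset q) k.
  by rewrite -qp; apply: (chain_between_ext cD cM cE c1 phi_integral k nB iI pq).
have ireg k : (exists2 r, size r = k & lreg (pset p) I r) <->
    (exists2 r, size r = k & lreg (pset q) (ext phi I) r).
  rewrite -qp; split=> -[r <- regr].
    exists [seq phi x | x <- r]; first by rewrite size_map.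
    exact: (lreg_ext cD cM cE pq iI).
  exact: (lreg_descent cD cM cE c1 phi_integral pq nA nB iI).
rewrite !quo_local_CME //; last exact: ideal_gen_ideal.
have eD : [set k | chain_between I (pset p) k] =
    [set k | chain_between (ext phi I) (pset q) k].
  by apply/seteqP; split=> k /ichain.
have eG : [set k | exists2 r, size r = k & lreg (pset p) I r] =
    [set k | exists2 r, size r = k & lreg (pset q) (ext phi I) r].
  by apply/seteqP; split=> k /ireg.
by rewrite eD eG.
Qed.

(** The primes of [B] containing the extension of [I] lie over primes containing
    [I], and each of the latter is hit by lying over. *)
Lemma Cohen_Macaulay_ext (I : set A) : is_ideal I ->
  Cohen_Macaulay_ideal I <-> Cohen_Macaulay_ideal (ext phi I).
Proof.
move=> iI; split=> [CM q Iq | CM p Ip].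
  have [p pE] := prime_idealr_of (preimage_prime phi (psetP q)).
  have Ip : I `<=` pset p.
    by rewrite pE => a Ia; apply: Iq; apply: ideal_gen_sub; exists a.
  by apply/(quo_local_CM_ext iI Ip (esym pE))/CM.
have [Q pQ Qp] := lying_over cD cM cE c1 nB (psetP p).
have [q qE] := prime_idealr_of pQ.
apply/(quo_local_CM_ext (q := q) iI Ip); first by rewrite qE.
apply: CM; rewrite qE; apply: ideal_gen_min; first exact: prime_ideal.
by move=> _ [a /Ip pa <-]; move: pa; rewrite -Qp.
Qed.

End CohenMacaulayExtension.

(** * Powers and extensions of ideals *)

Section IdealPowers.
Variable R : comNzRingType.
Implicit Types (G I : set R).

Lemma ideal_exp_gen G n : ideal_exp (ideal_gen G) n =
  ideal_gen [set \prod_(i < n) f i | f in [set f : 'I_n -> R | forall i, G (f i)]].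
Proof.
pose prods H k := [set \prod_(i < k) f i | f in
  [set f : 'I_k -> R | forall i, H (f i)]] : set R.
rewrite /ideal_exp -/(prods _ n) -/(prods G n).
apply/seteqP; split; apply: ideal_gen_min; try exact: ideal_gen_ideal; last first.
  move=> _ [f Gf <-]; apply: ideal_gen_sub; exists f => // i.
  by apply: ideal_gen_sub; apply: Gf.
move=> _ [f Gf <-]; elim: n f Gf => [|n IHn] f Gf.
  rewrite big_ord0; apply: ideal_gen_sub; exists f; last by rewrite big_ord0.
  by case.
have ig H : is_ideal (ideal_gen H : set R) by apply: ideal_gen_ideal.
rewrite big_ord_recr /=.
have := IHn (fun i => f (widen_ord (leqnSn n) i)) (fun i => Gf _).
apply: (@ideal_gen_min _ _ (colon (ideal_gen (prods G n.+1)) (f ord_max))).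
  exact: colon_ideal.
move=> _ [g Gg <-]; rewrite /colon /= mulrC; move: (Gf ord_max).
apply: (@ideal_gen_min _ _
  (colon (ideal_gen (prods G n.+1)) (\prod_(i < n) g i))).
  exact: colon_ideal.
move=> h Gh; apply: ideal_gen_sub.
exists (fun i => if unlift ord_max i is Some j then g j else h).
  by move=> i; case: unliftP => [j _|_]; [apply: Gg|].
rewrite big_ord_recr /= unlift_none mulrC; congr (_ * _).
apply: eq_bigr => i _; rewrite (_ : widen_ord _ i = lift ord_max i) ?liftK //.
by apply: val_inj; rewrite /= /bump leqNgt ltn_ord.
Qed.

End IdealPowers.

Lemma ext_gen (A B : comNzRingType) (phi : {rmorphism A -> B}) (G : set A) :
  ext phi (ideal_gen G) = ideal_gen (phi @` G).
Proof.
apply/seteqP; split; apply: ideal_gen_min; try exact: ideal_gen_ideal.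
  move=> _ [_ [n [a [g [Gg ->]]]] <-]; rewrite rmorph_sum.
  apply: ideal_sum => [|i _]; first exact: ideal_gen_ideal.
  rewrite rmorphM; apply: idealMl; first exact: ideal_gen_ideal.
  by apply: ideal_gen_sub; exists (g i).
by move=> _ [g Gg <-]; apply: ideal_gen_sub; exists g => //; apply: ideal_gen_sub.
Qed.

Lemma ext_exp (A B : comNzRingType) (phi : {rmorphism A -> B}) (I : set A) n :
  is_ideal I -> ext phi (ideal_exp I n) = ideal_exp (ext phi I) n.
Proof.
move=> iI; rewrite ideal_exp_gen /ideal_exp ext_gen; congr ideal_gen.
apply/seteqP; split=> [_ [_ [f If <-] <-] | _ [f If <-]].
  exists (phi \o f); last by rewrite rmorph_prod.
  by move=> i; exists (f i) => //; apply: If.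
have /choice[g gP] : forall i, exists a, I a /\ phi a = f i.
  by move=> i; have [a Ia <-] := If i; exists a.
exists (\prod_i g i).
  by exists g => // i; have [] := gP i.
by rewrite rmorph_prod; apply: eq_bigr => i _; have [] := gP i.
Qed.

(** * Monomial ideals *)

Section Monomial.
Variables (K : fieldType) (n : nat).
Local Notation S := {mpoly K[n]}.
Implicit Types (J P : set S) (f g : S) (m a b : 'X_{1..n}).

Definition is_monomial J : Prop :=
  is_ideal J /\ forall f, J f -> forall m, m \in msupp f -> J 'X_[m].

Lemma ideal_monomials J f :
  is_ideal J -> (forall m, m \in msupp f -> J 'X_[m]) -> J f.
Proof.
move=> iJ Jf; rewrite (mpolyE f) big_seq; apply: ideal_sum => // m /Jf Jm.
by rewrite -mul_mpolyC; apply: idealMl.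
Qed.

Lemma monomial_ext J J' : is_monomial J -> is_monomial J' ->
  (forall m, J 'X_[m] <-> J' 'X_[m]) -> J = J'.
Proof.
move=> [iJ mJ] [iJ' mJ'] e; apply/seteqP; split=> f Jf; apply: ideal_monomials => //.
  by move=> m /(mJ _ Jf)/e.
by move=> m /(mJ' _ Jf)/e.
Qed.

Lemma mem_msuppMX f m a : ((m + a)%MM \in msupp ('X_[m] * f)) = (a \in msupp f).
Proof. by rewrite !mcoeff_msupp mulrC mcoeffMX. Qed.

Lemma monomial_ideal_gen (M : set 'X_{1..n}) :
  is_monomial (ideal_gen [set 'X_[a] | a in M]).
Proof.
pose H : set S := [set f | forall m, m \in msupp f -> exists2 a, M a & (a <= m)%MM].
have iH : is_ideal H.
  split=> [m|f g Hf Hg m|g f Hf m]; first by rewrite msupp0.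
    by move/msuppD_le; rewrite mem_cat => /orP[/Hf|/Hg].
  move/msuppM_le => /allpairsP[[b c] /= [_ /Hf[a Ma leac] ->]].
  by exists a => //; apply: lepm_trans leac (lem_addl _ _).
split=> [|f If m mf]; first exact: ideal_gen_ideal.
have [a Ma leam] : exists2 a, M a & (a <= m)%MM.
  suff : H f by apply.
  move: If; apply: ideal_gen_min => // _ [a Ma <-] m'.
  by rewrite msuppX inE => /eqP ->; exists a => //; apply: lepm_refl.
rewrite -(submK leam) mpolyXD; apply: idealMl; first exact: ideal_gen_ideal.
by apply: ideal_gen_sub; exists a.
Qed.

Lemma monomial_idealP J : monomial_ideal J -> is_monomial J.
Proof. by case=> M ->; apply: monomial_ideal_gen. Qed.

Lemma monomial_ideal_exp J k : monomial_ideal J -> is_monomial (ideal_exp J k).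
Proof.
case=> M ->; rewrite ideal_exp_gen.
set G := [set _ | _ in _].
rewrite (_ : G = [set 'X_[a] | a in [set a | G 'X_[a]]]).
  exact: monomial_ideal_gen.
apply/seteqP; split=> [x [f fM xE] | _ [a Ga <-]//].
have /choice[a aP] : forall i, exists a, M a /\ 'X_[a] = f i.
  by move=> i; have [a Ma <-] := fM i; exists a.
have xX : x = 'X_[\sum_i a i].
  by rewrite -xE -mprodXE; apply: eq_bigr => i _; have [_ <-] := aP i.
exists (\sum_i a i)%MM => //; rewrite /= -xX.
by exists f.
Qed.

Lemma colon_monomial J a : is_monomial J -> is_monomial (colon J 'X_[a]).
Proof.
move=> [iJ mJ]; split=> [|f]; first exact: colon_ideal.
rewrite /colon /= => Jf m mf; rewrite -mpolyXD addmC; apply: (mJ _ Jf).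
by rewrite mulrC mem_msuppMX.
Qed.

(** Let [g] be in the prime [P = (J : f)].  The product of the leading monomials
    of [g] and [f] is in [J].  If the leading monomial [t^b] of [g] were not in
    [P], then [P = (J : t^b f) = (J : t^b f')] with [f'] obtained from [f] by
    deleting its leading term, and by induction on the number of terms [P]
    would be monomial and contain [t^b] after all. *)
Lemma assoc_prime_monomial J f : is_monomial J ->
  is_prime (colon J f) -> is_monomial (colon J f).
Proof.
move=> mJ; have [iJ suppJ] := mJ; have [k] := ubnP (size (msupp f)).
elim: k f => // k IHk f ltk pP; split=> [|g]; first exact: prime_ideal.
have f0 : f != 0.
  apply: contra_notN (notin_prime1 pP) => /eqP ->.
  by rewrite /colon /= mulr0; apply: ideal0.
have lead h : h != 0 -> colon J f h -> colon J f 'X_[mlead h].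
  move=> h0 Jhf; apply: contrapT => notP.
  set b := mlead h in notP *; set a := mlead f.
  have Jab : J 'X_[b + a].
    apply: (suppJ _ Jhf); rewrite -mleadM //; apply: mlead_supp.
    by rewrite mulf_neq0.
  pose f' := f - f@_a *: 'X_[a].
  have Ef' : colon J ('X_[b] * f') = colon J f.
    have Jx x : J (x * ('X_[b] * (f@_a *: 'X_[a]))).
      apply: idealMl => //; rewrite -scalerAr -mpolyXD -mul_mpolyC.
      exact: idealMl.
    apply/seteqP; split=> x; rewrite /colon /= => Jxf.
      have : colon J f (x * 'X_[b]).
        rewrite /colon /= -mulrA -(subrK (f@_a *: 'X_[a]) f) -/f'.
        by rewrite mulrDr mulrDr; apply: idealD.
      by case/(primeM pP).
    rewrite /f' mulrBr mulrBr; apply: idealB => //.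
    by rewrite mulrCA; apply: idealMl.
  have [||_ mP] := IHk ('X_[b] * f').
  - rewrite mulrC (perm_size (msuppMX _ _)) size_map.
    have := perm_size (msupp_rem f a); rewrite -/f' => ->.
    rewrite size_rem ?mlead_supp // prednK //.
    by rewrite lt0n size_eq0 msupp_eq0.
  - by rewrite Ef'.
  by apply: notP; rewrite -Ef'; apply: (mP h); rewrite ?Ef' ?mlead_supp.
have [l] := ubnP (size (msupp g)); elim: l g => // l IHl g ltl Pg m mg.
have g0 : g != 0 by apply: contraTneq mg => ->; rewrite msupp0.
have [->|mlg] := eqVneq m (mlead g); first exact: lead.
have rem_g := msupp_rem g (mlead g).
apply: (IHl (g - g@_(mlead g) *: 'X_[mlead g])).
- rewrite (perm_size rem_g) size_rem ?mlead_supp // prednK //.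
  by rewrite lt0n size_eq0 msupp_eq0.
- apply: idealB => //; first exact: prime_ideal.
  rewrite -mul_mpolyC; apply: idealMl; first exact: prime_ideal.
  exact: lead.
- by rewrite (perm_mem rem_g) mem_rem_uniq ?msupp_uniq // inE mlg.
Qed.

(** [(J : f)] is the intersection of the [(J : t^a)] over the monomials of [f];
    being prime, it equals one of them. *)
Lemma assoc_prime_colon_monomial J f : is_monomial J -> is_prime (colon J f) ->
  exists a, colon J f = colon J 'X_[a].
Proof.
move=> mJ pP; have [_ mP] := assoc_prime_monomial mJ pP; have [iJ suppJ] := mJ.
have sub a : a \in msupp f -> colon J f `<=` colon J 'X_[a].
  move=> af g Pg; apply: ideal_monomials; first exact: colon_ideal.
  move=> m /(mP _ Pg) Jmf; rewrite /colon /= -mpolyXD; apply: (suppJ _ Jmf).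
  by rewrite mem_msuppMX.
apply: contrapT => noa.
have /choice[h hP] a : exists h, a \in msupp f -> J (h * 'X_[a]) /\ ~ J (h * f).
  have [af|_] := boolP (a \in msupp f); last by exists 0.
  apply: contrapT => noh; apply: noa; exists a; apply/seteqP; split.
    exact: sub.
  by move=> h Jha; apply: contrapT => nJ; apply: noh; exists h.
have : colon J f (\prod_(a <- msupp f) h a).
  rewrite /colon /= [X in J (_ * X)]mpolyE mulr_sumr big_seq.
  apply: ideal_sum => // a af; rewrite -scalerAr -mul_mpolyC; apply: idealMl => //.
  rewrite (big_rem a) //= mulrAC; apply: idealMr => //.
  by have [] := hP a af.
by case/(prime_prod pP) => a af; have [] := hP a af.
Qed.

Lemma prime_monomialE P m : is_prime P ->
  P 'X_[m] <-> exists2 i, m i != 0%N & P 'X_i.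
Proof.
move=> pP; have iP := prime_ideal pP; rewrite mpolyXE_id; split=> [|[i mi Pi]].
  case/(prime_prod pP) => i _; have [->|mi] := eqVneq (m i) 0%N.
    by rewrite expr0 => /notin_prime1.
  by move=> /(prime_exp pP); exists i.
rewrite (bigD1 i) //=; apply: idealMr => //.
by rewrite -(prednK (n := m i)) ?lt0n // exprS; apply: idealMr.
Qed.

(** The ideal [N] of elements multiplied into [J] by a monomial outside [P] is
    monomial, and all its associated primes are contained in [P]: they are
    monomial, and monomials outside [P] are nonzerodivisors modulo [N].  So no
    element outside [P] is a zero divisor modulo [N]. *)
Lemma sat_monomial P J g : is_prime P -> is_monomial J ->
  sat P J g -> exists2 b, ~ P 'X_[b] & J ('X_[b] * g).
Proof.
move=> pP mJ; have [iJ suppJ] := mJ.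
pose N : set S := [set g | exists2 b, ~ P 'X_[b] & J ('X_[b] * g)].
have iN : is_ideal N.
  split=> [|x y [b Pb Jx] [c Pc Jy]|x y [b Pb Jy]].
  - exists 0%MM; rewrite ?mpolyX0 ?mulr0; first exact: notin_prime1.
    exact: ideal0.
  - exists (b + c)%MM; rewrite mpolyXD; first exact: notin_primeM.
    rewrite mulrDr; apply: idealD => //.
      by rewrite mulrAC; apply: idealMr.
    by rewrite -mulrA; apply: idealMl.
  - by exists b; rewrite // mulrCA; apply: idealMl.
have mN : is_monomial N.
  split=> // f [b Pb Jf] m mf; exists b; rewrite // -mpolyXD.
  by apply: (suppJ _ Jf); rewrite mem_msuppMX.
move=> [s Ps Jsg]; apply: contrapT => Ng.
have Nsg : N (s * g).
  by exists 0%MM; rewrite mpolyX0 ?mul1r //; apply: notin_prime1.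
have nS : noetherian S by apply: noetherian_mpoly.
have [Q [[pQ [u Qu]] Qs]] := zero_divisor_assoc_prime nS iN Nsg Ng.
have pQu : is_prime (colon N u) by rewrite -Qu.
have [a Ea] := assoc_prime_colon_monomial mN pQu.
have [_ mQ] := assoc_prime_monomial mN pQu.
apply: Ps; apply: ideal_monomials; first exact: prime_ideal.
move=> m ms; apply: contrapT => Pm.
have : colon N u 'X_[m] by apply: (mQ s) => //; rewrite -Qu.
rewrite Ea => -[b Pb Jbma]; apply: (notin_prime1 pQu); rewrite Ea /colon /=.
exists (b + m)%MM; rewrite mpolyXD; first exact: notin_primeM.
by rewrite mul1r -mulrA.
Qed.

End Monomial.

(** * The substitution t_i -> t_i^(d_i) *)

Section Weighting.
Variables (K : fieldType) (n : nat) (w : 'X_{1..n} -> 'X_{1..n}) (d : 'I_n -> nat).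
Hypothesis d_gt0 : forall i, (0 < d i)%N.
Hypothesis wE : forall (a : 'X_{1..n}) i, w a i = (d i * a i)%N.
Local Notation S := {mpoly K[n]}.
Implicit Types (J P : set S) (f g : S) (a b m r : 'X_{1..n}).

Definition wsubst : {rmorphism S -> S} :=
  mmap (@mpolyC n K) (fun i => 'X_[w U_(i)]).

Definition wdiv m : 'X_{1..n} := [multinom (m i %/ d i)%N | i < n].
Definition wmod m : 'X_{1..n} := [multinom (m i %% d i)%N | i < n].

Lemma wdivmod m : (w (wdiv m) + wmod m)%MM = m.
Proof. by apply/mnmP => i; rewrite mnmDE wE !mnmE mulnC -divn_eq. Qed.

Lemma wdivD a m : wdiv (w a + m)%MM = (a + wdiv m)%MM.
Proof.
apply/mnmP => i; rewrite !(mnmDE, mnmE) wE mulnC.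
by rewrite divnMDl.
Qed.

Lemma wmodD a m : wmod (w a + m)%MM = wmod m.
Proof. by apply/mnmP => i; rewrite !(mnmDE, mnmE) wE mulnC modnMDl. Qed.

Lemma wmod_id m : wmod (wmod m) = wmod m.
Proof. by apply/mnmP => i; rewrite !mnmE modn_mod. Qed.

Lemma lem_w a : (a <= w a)%MM.
Proof. by apply/mnm_lepP => i; rewrite wE leq_pmull. Qed.

Lemma wsubstX m : wsubst 'X_[m] = 'X_[w m].
Proof.
rewrite /= mmapX /mmap1.
under eq_bigr => i _ do rewrite mpolyXn.
rewrite mprodXE; congr 'X_[_]; apply/mnmP => i; rewrite mnm_sumE wE.
rewrite (bigD1 i) //= big1 => [|j ji]; rewrite mulmnE wE mnm1E.
  by rewrite eqxx muln1 addn0.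
by rewrite (negPf ji) muln0.
Qed.

Lemma wsubstZ k f : wsubst (k *: f) = k *: wsubst f.
Proof. by rewrite /= mmapZ mul_mpolyC. Qed.

Lemma wsubstC k : wsubst k%:MP = k%:MP.
Proof. by rewrite /= mmapC. Qed.

(** The coordinate of [f] on [t^r], set to zero unless [r] is reduced, that is
    [r_i < d_i] for all [i], since only reduced exponents index the basis. *)
Definition wcomp r f : S :=
  if wmod r == r then
    \sum_(m : 'X_{1..n < msize f}) f@_(w m + r) *: 'X_[m] else 0.

Lemma wcompE r f m :
  (wcomp r f)@_m = if wmod r == r then f@_(w m + r) else 0.
Proof.
rewrite /wcomp; case: ifP => _; last by rewrite mcoeff0.
have [ltm|lem] := ltnP (mdeg m) (msize f).
  exact: (mcoeff_mpoly (fun m => f@_(w m + r))).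
rewrite raddf_sum /= big1 => [|m' _]; last first.
  rewrite mcoeffZ mcoeffX; case: eqP => [mm'|]; last by rewrite mulr0.
  by have := bmdeg m'; rewrite mm' ltnNge lem.
apply/esym/memN_msupp_eq0/msize_mdeg_ge; apply: leq_trans lem _.
rewrite mdegD; apply: leq_trans (leq_addr _ _).
rewrite !mdegE; apply: leq_sum => i _; exact: (mnm_lepP (lem_w m)).
Qed.

Lemma wcompD r : {morph wcomp r : f g / f + g}.
Proof.
move=> f g; apply/mpolyP => m; rewrite mcoeffD !wcompE mcoeffD.
by case: ifP => //; rewrite addr0.
Qed.

Lemma wcompZ r k f : wcomp r (k *: f) = k *: wcomp r f.
Proof.
apply/mpolyP => m; rewrite mcoeffZ !wcompE mcoeffZ.
by case: ifP => //; rewrite mulr0.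
Qed.

Lemma wcomp0 r : wcomp r 0 = 0.
Proof. by apply/mpolyP => m; rewrite wcompE !mcoeff0 if_same. Qed.

(** The coordinates of a monomial come from Euclidean division of its exponent,
    which determines the quotient and the reduced remainder. *)
Lemma wcompX r m : wcomp r 'X_[m] = if wmod m == r then 'X_[wdiv m] else 0.
Proof.
apply/mpolyP => a; rewrite wcompE mcoeffX.
have [<-|mr] := eqVneq (wmod m) r.
  rewrite wmod_id eqxx mcoeffX -{1}[m]wdivmod eqm_add2r.
  have [->|aE] := eqVneq (wdiv m) a; first by rewrite eqxx.
  case: eqP => // ew; case/eqP: aE.
  apply/mnmP => i; have := congr1 (fun b : 'X_{1..n} => b i) ew.
  by rewrite !wE => /eqP; rewrite eqn_pmul2l // => /eqP.
rewrite mcoeff0; case: eqP => // rr.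
case: eqP => // mE; case/eqP: mr.
by rewrite mE wmodD.
Qed.

Lemma wcompM r f g : wcomp r (wsubst f * g) = f * wcomp r g.
Proof.
elim/mpolyind: f => [|k m f _ _ IHf].
  by rewrite rmorph0 !mul0r wcomp0.
rewrite rmorphD !mulrDl wcompD IHf; congr (_ + _).
rewrite wsubstZ wsubstX -!scalerAl wcompZ; congr (_ *: _).
elim/mpolyind: g {IHf} => [|l a g _ _ IHg].
  by rewrite mulr0 wcomp0 mulr0.
rewrite mulrDr !wcompD IHg mulrDr; congr (_ + _).
rewrite -scalerAr !wcompZ -mpolyXD !wcompX wmodD wdivD.
by case: ifP => _; rewrite ?scaler0 ?mulr0 // mpolyXD scalerAr.
Qed.

Let N := (\sum_i d i).+1.

Lemma wmod_bound m : (mdeg (wmod m) < N)%N.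
Proof.
rewrite ltnS mdegE; apply: leq_sum => i _.
by rewrite mnmE; apply/ltnW/ltn_pmod.
Qed.

Lemma wcomp_sum f : f = \sum_(r : 'X_{1..n < N}) wsubst (wcomp r f) * 'X_[r].
Proof.
elim/mpolyind: f => [|k m f _ _ IHf].
  by rewrite big1 // => r _; rewrite wcomp0 rmorph0 mul0r.
under eq_bigr => r _ do rewrite wcompD rmorphD mulrDl.
rewrite big_split /= -IHf; congr (_ + _).
under eq_bigr => r _ do rewrite wcompZ wsubstZ -scalerAl.
rewrite -scaler_sumr; congr (_ *: _).
rewrite (bigD1 (BMultinom (wmod_bound m))) //= big1 => [|r rm]; rewrite wcompX.
  by rewrite eqxx wsubstX -mpolyXD wdivmod addr0.
rewrite eq_sym -[wmod m]/(bmnm (BMultinom (wmod_bound m))).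
by rewrite (negPf (_ : bmnm r != _)) ?rmorph0 ?mul0r.
Qed.

Lemma wcomp01 : wcomp 0%MM 1 = 1.
Proof.
rewrite -mpolyX0 wcompX (_ : wmod 0 = 0%MM) ?eqxx.
  by congr 'X_[_]; apply/mnmP => i; rewrite !mnmE div0n.
by apply/mnmP => i; rewrite !mnmE mod0n.
Qed.

Lemma wcomp0K f : wcomp 0%MM (wsubst f) = f.
Proof. by rewrite -[wsubst f]mulr1 wcompM wcomp01 mulr1. Qed.

(** Each variable [t_i] is a root of [X^(d_i) - phi t_i]. *)
Lemma wsubst_integral : integralRange wsubst.
Proof.
move=> f; rewrite [f]mpolyE; elim/big_ind: _ => [|x y|m _].
- exact: integral0.
- exact: integral_add.
rewrite -mul_mpolyC; apply: integral_mul.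
  by rewrite -wsubstC; apply: integral_id.
rewrite mpolyXE_id; elim/big_ind: _ => [|x y|i _].
- exact: integral1.
- exact: integral_mul.
elim: (m i) => [|k IHk]; first by rewrite expr0; apply: integral1.
rewrite exprS; apply: integral_mul => {IHk} //.
exists ('X^(d i) - ('X_i)%:P); first exact: monicXnsubC.
rewrite rmorphB /= map_polyXn map_polyC /= -/wsubst.
rewrite rootE !hornerE /= -[mmap _ _ _]/(wsubst _) wsubstX mpolyXn subr_eq0.
apply/eqP; congr 'X_[_]; apply/mnmP => j.
by rewrite mulmnE wE mnm1E mulnC; case: eqP => [->|_]; rewrite ?muln0.
Qed.

End Weighting.

(** * The weighted monomial ideal *)

Section WeightedIdeal.
Variables (K : fieldType) (n : nat) (w : 'X_{1..n} -> 'X_{1..n}) (d : 'I_n -> nat).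
Hypothesis d_gt0 : forall i, (0 < d i)%N.
Hypothesis wE : forall (a : 'X_{1..n}) i, w a i = (d i * a i)%N.
Local Notation S := {mpoly K[n]}.
Local Notation phi := (wsubst K w).
Implicit Types (I J P : set S) (f g : S) (a b m : 'X_{1..n}).

Let comp (r : 'X_{1..n < (\sum_i d i).+1}) : S -> S := wcomp w d r.
Let compD r : {morph comp r : f g / f + g} := wcompD d_gt0 wE r.
Let compM r f g : comp r (phi f * g) = f * comp r g := wcompM d_gt0 wE r f g.
Let compE f : f = \sum_r phi (comp r f) * 'X_[r] := wcomp_sum d_gt0 wE f.
Let comp1 : comp bm0 1 = 1 := wcomp01 K d_gt0 wE.

Lemma weighted_idealE J : is_monomial J -> weighted_ideal w J = ext phi J.
Proof.
move=> [iJ mJ]; apply/seteqP; split; apply: ideal_gen_min;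
  try exact: ideal_gen_ideal.
  move=> _ [a Ja <-]; rewrite -(wsubstX K wE).
  by apply: ideal_gen_sub; exists 'X_[a].
move=> _ [f Jf <-]; rewrite (mpolyE f) rmorph_sum big_seq.
apply: ideal_sum => [|m /(mJ _ Jf) Jm]; first exact: ideal_gen_ideal.
rewrite -mul_mpolyC rmorphM; apply: idealMl; first exact: ideal_gen_ideal.
by apply: ideal_gen_sub; exists m => //; rewrite (wsubstX K wE).
Qed.

Lemma ext_monomial J : is_monomial J -> is_monomial (ext phi J).
Proof.
move=> mJ; rewrite -weighted_idealE // /weighted_ideal.
have := monomial_ideal_gen K (w @` [set a | J 'X_[a]]).
by rewrite image_comp.
Qed.

Lemma ext_monomialP J m :
  is_monomial J -> ext phi J 'X_[m] <-> J 'X_[wdiv d m].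
Proof.
move=> [iJ _]; split=> [/(extP compD compM compE _ iJ)|Jm].
  move/(_ (BMultinom (wmod_bound d_gt0 m))).
  by rewrite /comp (wcompX K d_gt0 wE) eqxx.
rewrite -(wdivmod wE m) mpolyXD -(wsubstX K wE).
apply: idealMr; first exact: ideal_gen_ideal.
by apply: ideal_gen_sub; exists 'X_[wdiv d m].
Qed.

Lemma prime_monomial_w P m : is_prime P -> P 'X_[w m] <-> P 'X_[m].
Proof.
move=> pP; split=> /(prime_monomialE _ pP)[i mi Pi];
  apply/(prime_monomialE _ pP); exists i => //; move: mi;
  by rewrite wE muln_eq0 (gtn_eqF (d_gt0 i)).
Qed.

Lemma prime_monomial_wsubst P f :
  is_prime P -> is_monomial P -> P (phi f) -> P f.
Proof.
move=> pP [iP mP] Pf; apply: ideal_monomials => // m mf.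
apply/(prime_monomial_w _ pP)/(mP _ Pf); move: mf; rewrite !mcoeff_msupp.
rewrite -{1}(wcomp0K d_gt0 wE f) (wcompE d_gt0 wE) addm0.
by case: ifP => //; rewrite eqxx.
Qed.

(** With [P = (J : t^a)], a monomial [t^m] sends [t^b] into the extension of [J]
    if and only if [t^(m / d)] does so with [t^a], the quotient being rounded up;
    this rounding keeps the support of [m], on which membership in [P] depends. *)
Lemma Ass_ext J : is_monomial J -> Ass (ext phi J) = Ass J.
Proof.
move=> mJ; have mJ' := ext_monomial mJ.
apply/seteqP; split=> p [f pE]; have pp := psetP p; rewrite pE in pp.
  have [b Eb] := assoc_prime_colon_monomial mJ' pp.
  exists 'X_[wdiv d b]; rewrite pE Eb; rewrite Eb in pp.
  apply: monomial_ext; try exact: colon_monomial.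
  move=> m; rewrite -(prime_monomial_w _ pp) /colon /= -!mpolyXD.
  by rewrite ext_monomialP // wdivD.
have [a Ea] := assoc_prime_colon_monomial mJ pp.
(* The largest exponent with quotient a: any further factor t_i raises the i-th
   entry of the quotient. *)
pose b := [multinom (w a i + (d i).-1)%N | i < n].
exists 'X_[b]; rewrite pE Ea; rewrite Ea in pp.
apply: monomial_ext; try exact: colon_monomial.
move=> m; rewrite [colon (ext _ _) _ _]/colon /= -mpolyXD ext_monomialP //.
pose u := [multinom (m i + (d i).-1) %/ d i | i < n]%N.
have -> : wdiv d (m + b)%MM = (u + a)%MM.
  apply/mnmP => i; rewrite !(mnmDE, mnmE) wE addnCA mulnC.
  by rewrite divnMDl // addnC.
have -> : J 'X_[u + a] <-> colon J 'X_[a] 'X_[u].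
  by rewrite /colon /= -mpolyXD.
have u0 i : (u i != 0%N) = (m i != 0%N).
  rewrite mnmE -!lt0n divn_gt0 //; case: (m i) => [|k].
    by rewrite add0n leqNgt prednK // leqnn.
  by rewrite addSn -addnS prednK // leq_addl.
by split=> /(prime_monomialE _ pp)[i ui Ji]; apply/(prime_monomialE _ pp);
  exists i => //; move: ui; rewrite u0.
Qed.

Lemma symbolic_powerE I k : symbolic_power I k =
  [set f | forall p, minAss I p -> sat (pset p) (ideal_exp I k) f].
Proof.
apply/seteqP; split=> f If p Ip;
  by apply/(@ideal_loc_to_loc _ p _ f (ideal_gen_ideal _)); apply: If.
Qed.

Lemma SimisE I k : Simis_in_degree k I <->
  forall f, (forall p, minAss I p -> sat (pset p) (ideal_exp I k) f) ->
    ideal_exp I k f.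
Proof.
rewrite /Simis_in_degree symbolic_powerE; split=> [E f If|E]; first by rewrite -E.
apply/seteqP; split=> [f /E//|f If p _]; exact: (sub_sat (psetP p) If).
Qed.

(** Both ideals have the same minimal primes, so membership in the [k]-th symbolic
    power is tested at the same primes.  A denominator outside a monomial prime
    may be taken to be a monomial [t^b], then multiplied up to [phi t^b], and as
    such it acts coordinatewise. *)
Lemma Simis_in_degree_ext I k : monomial_ideal I ->
  Simis_in_degree k I <-> Simis_in_degree k (ext phi I).
Proof.
move=> mmI; have mI := monomial_idealP mmI; have [iI _] := mI.
have mJ := monomial_ideal_exp k mmI; have [iJ _] := mJ.
have mJ' := ext_monomial mJ.
rewrite !SimisE -ext_exp // /minAss Ass_ext //; set J := ideal_exp I k.
split=> simis f sf; last first.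
  apply/(ext_phi compD compM compE comp1) => //; apply: simis => p mp.
  have [s ps Js] := sf p mp; exists (phi s).
    have pp := psetP p; have [[g pE] _] := mp.
    move=> /(prime_monomial_wsubst pp) ps'; apply/ps/ps'.
    by rewrite pE; apply: assoc_prime_monomial; rewrite -?pE.
  by rewrite -rmorphM; apply: ideal_gen_sub; exists (s * f).
apply/(extP compD compM compE) => // r; apply: simis => p mp.
have [b pb Jb] := sat_monomial (psetP p) mJ' (sf p mp).
exists 'X_[b] => //; rewrite -compM (wsubstX K wE).
suff /(extP compD compM compE _ iJ) : ext phi J ('X_[w b] * f) by apply.
rewrite -(submK (lem_w d_gt0 wE b)) mpolyXD -mulrA.
by apply: idealMl => //; apply: ideal_gen_ideal.
Qed.

Lemma Cohen_Macaulay_weighted J : is_ideal J ->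
  Cohen_Macaulay_ideal J <-> Cohen_Macaulay_ideal (ext phi J).
Proof.
move=> iJ; have nS : noetherian S by apply: noetherian_mpoly.
by apply: (Cohen_Macaulay_ext compD compM compE comp1
  (wsubst_integral d_gt0 wE)).
Qed.

End WeightedIdeal.

Theorem corollary5p5 (K : fieldType) (s : nat)
  (w : 'X_{1..s} -> 'X_{1..s}) (hw : standard_linear_weighting w)
  (I : set {mpoly K[s]}) (hI : monomial_ideal I) :
  (embedded_primes I = set0 -> forall n : nat, (1 <= n)%N ->
     (Simis_in_degree n I <-> Simis_in_degree n (weighted_ideal w I)))
  /\ (Simis I <-> Simis (weighted_ideal w I))
  /\ (forall n : nat, (1 <= n)%N ->
        Ass (ideal_exp I n) = Ass (ideal_exp (weighted_ideal w I) n))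
  /\ (normally_torsion_free I <-> normally_torsion_free (weighted_ideal w I))
  /\ (Cohen_Macaulay_ideal I <-> Cohen_Macaulay_ideal (weighted_ideal w I))
  /\ (unmixed I <-> unmixed (weighted_ideal w I)).
Proof.
have [d d_gt0 wE] := hw; have mI := monomial_idealP hI; have [iI _] := mI.
rewrite (weighted_idealE wE mI).
have simis n := Simis_in_degree_ext d_gt0 wE n hI.
have AssI : Ass (ext (wsubst K w) I) = Ass I := Ass_ext d_gt0 wE mI.
have AssE n : Ass (ideal_exp (ext (wsubst K w) I) n) = Ass (ideal_exp I n).
  by rewrite -ext_exp //; apply: (Ass_ext d_gt0 wE); apply: monomial_ideal_exp.
split; first by move=> _ n _.
split; first by split=> sI n n_gt0; apply/simis; apply: sI.
split; first by move=> n _; rewrite AssE.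
split.
  by split=> tf n n_gt0; have := tf n n_gt0; rewrite AssE AssI.
split; first exact: (Cohen_Macaulay_weighted d_gt0 wE iI).
by rewrite /unmixed AssI.
Qed.
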